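(* The set of group-like elements $G(\mathbf{k}\langle\langle\mathcal{PT}\rangle\rangle)$ is equal to $\{\exp(x)\mid x\in\widehat{Lie}(\mathbf{k}\{\mathcal{PT}\})\}$, and its post-group structure is given by $$\exp(x)\cdot\exp(y)=\exp\big(\mathsf{BCH}(x,y)\big),\qquad \exp(x)\rhd\exp(y)=\exp\Big(\exp(L^\rhd_{\Omega(x)})(y)\Big)$$ for all $x,y\in\widehat{Lie}(\mathbf{k}\{\mathcal{PT}\})$. Moreover, the group structure of the Lie-Butcher group $G_{\mathrm{LB}}=\{\exp(x)\mid x\in\widehat{Lie}(\mathbf{k}\{\mathcal{PT}\})\}$ is given by $$\exp(x)*_\rhd\exp(y)=\exp\Big(\mathsf{BCH}\big(x,\exp(L^\rhd_{\Omega(x)})(y)\big)\Big)\qquad\text{for all }x,y\in\widehat{Lie}(\mathbf{k}\{\mathcal{PT}\}).$$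
   Context: $\mathbf{k}$ is a field of characteristic zero. Post-group: a group $(G,\cdot)$ with a binary operation $\rhd$ such that each $b\mapsto a\rhd b$ is an automorphism of $(G,\cdot)$ and $(a\cdot(a\rhd b))\rhd c=a\rhd(b\rhd c)$ for all $a,b,c\in G$. $\mathcal{PT}$ is the set of isomorphism classes of (nonempty, finite) planar rooted trees and $\mathbf{k}\{\mathcal{PT}\}$ the vector space with basis $\mathcal{PT}$. The left grafting is $\tau\rhd\omega=\sum_{s\in\mathrm{Nodes}(\omega)}\tau\circ_s\omega$ for $\tau,\omega\in\mathcal{PT}$, where $\tau\circ_s\omega$ is the planar rooted tree obtained by attaching the root of $\tau$ (by a new edge) to the node $s$ of $\omega$ from the left. It extends uniquely to the free Lie algebra $Lie(\mathbf{k}\{\mathcal{PT}\})$ via $x\rhd[y,z]=[x\rhd y,z]+[y,x\rhd z]$ and $([x,y]+x\rhd y-y\rhd x)\rhd z=x\rhd(y\rhd z)-y\rhd(x\rhd z)$, making it a (free) post-Lie algebra, graded by the number of nodes. $\widehat{Lie}(\mathbf{k}\{\mathcal{PT}\})=\prod_{n\ge1}(Lie(\mathbf{k}\{\mathcal{PT}\}))_n$ is its completion, the product of its homogeneous components. The universal enveloping algebra of $Lie(\mathbf{k}\{\mathcal{PT}\})$ is the free associative algebra $\mathbf{k}\langle\mathcal{PT}\rangle$ on $\mathcal{PT}$, with concatenation product $\cdot$ and coshuffle coproduct $\Delta^{\mathrm{cosh}}$ (trees primitive). The operation $\rhd$ extends to $\mathbf{k}\langle\mathcal{PT}\rangle$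 by: $1\rhd a=a$; for $x,x_1,\ldots,x_n,a\in Lie(\mathbf{k}\{\mathcal{PT}\})$, $(x\cdot x_1\cdots x_n)\rhd a=x\rhd((x_1\cdots x_n)\rhd a)-\sum_{i=1}^n(x_1\cdots(x\rhd x_i)\cdots x_n)\rhd a$; $1\rhd1=1$, $x\rhd1=0$; and $X\rhd(a_1\cdots a_m)=\sum_X(X_{(1)}\rhd a_1)\cdots(X_{(m)}\rhd a_m)$ (iterated coproduct). Put $X*_\rhd Y=\sum_X X_{(1)}\cdot(X_{(2)}\rhd Y)$. $\mathbf{k}\langle\langle\mathcal{PT}\rangle\rangle$ is the completion of $\mathbf{k}\langle\mathcal{PT}\rangle$ with respect to the filtration by total number of nodes; all operations extend continuously. An element $g$ is group-like if $\Delta^{\mathrm{cosh}}(g)=g\hat\otimes g$ and $\varepsilon(g)=1$; $G(\mathbf{k}\langle\langle\mathcal{PT}\rangle\rangle)$ is the set of group-like elements, which with the restrictions of $\cdot$ and $\rhd$ is a post-group. The Lie-Butcher group $G_{\mathrm{LB}}$ is the same set of group-like elements with the multiplication $*_\rhd$. $\exp,\log$ are the exponential and logarithm power series in $\mathbf{k}\langle\langle\mathcal{PT}\rangle\rangle$ for the product $\cdot$, and $\log_{*_\rhd}$ is the logarithm power series for the product $*_\rhd$. For $x,y\in\widehat{Lie}(\mathbf{k}\{\mathcal{PT}\})$: $\mathsf{BCH}(x,y)=\log(\exp(x)\cdot\exp(y))$, $\Omega(x)=\log_{*_\rhd}(\exp(x))$ (both known to lie in $\widehat{Lie}(\mathbf{k}\{\mathcal{PT}\})$),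 $L^\rhd_x(y)=x\rhd y$, and $\exp(L^\rhd_x)=\sum_{n\ge0}\frac{(L^\rhd_x)^n}{n!}$. *)

(* Defs.v *)
From HB Require Import structures.
From mathcomp Require Import all_boot all_order all_algebra.
From mathcomp Require Import finmap monalg.
From mathcomp Require Import classical_sets.

Set Implicit Arguments.
Unset Strict Implicit.
Unset Printing Implicit Defensive.

Import GRing.Theory.

Local Open Scope ring_scope.

Inductive tree : Type := Node of seq tree.

(* A word in the alphabet of trees; nodes are counted with [weight]. *)
Definition forest : Type := seq tree.

Fixpoint tree_encode (t : tree) : GenTree.tree void :=
  let: Node ts := t in GenTree.Node 0 [seq tree_encode s | s <- ts].

Fixpoint tree_decode (g : GenTree.tree void) : tree :=
  match g with
  | GenTree.Leaf _ => Node [::]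
  | GenTree.Node _ gs => Node [seq tree_decode h | h <- gs]
  end.

Lemma tree_encodeK : cancel tree_encode tree_decode.
Proof.
rewrite /cancel; fix IH 1; case=> ts /=; congr Node; rewrite -map_comp.
by elim: ts => //= t ts ->; rewrite IH.
Qed.

HB.instance Definition _ := Countable.copy tree (can_type tree_encodeK).
HB.instance Definition _ := Countable.copy forest (seq tree).

Lemma forest_cat_eq_nil (u v : forest) :
  u ++ v = [::] -> u = [::] /\ v = [::].
Proof. by case: u => //= ->. Qed.

(* Forests form the free monoid on trees, so that [{malg k[forest]}] is the
   free associative algebra k<PT>. *)
HB.instance Definition _ := Choice_isMonomialDef.Build forest
  (@catA tree) (@cat0s tree) (@cats0 tree) forest_cat_eq_nil.

Fixpoint nodes (t : tree) : nat :=
  let: Node ts := t in (sumn [seq nodes s | s <- ts]).+1.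

Definition weight (w : forest) : nat := sumn [seq nodes t | t <- w].

Fixpoint forests_upto (n : nat) : seq forest :=
  if n is m.+1 then
    [::] :: [seq Node p.1 :: p.2 | p <-
       [seq (f, g) | f <- forests_upto m, g <- forests_upto m]
       & (weight p.1 + weight p.2 <= m)%N]
  else [:: [::]].

Lemma weight_cons (ts : seq tree) (g : forest) :
  weight (Node ts :: g) = (weight ts + weight g).+1.
Proof. by []. Qed.

Lemma mem_forests_upto (n : nat) (w : forest) :
  (w \in forests_upto n) = (weight w <= n)%N.
Proof.
elim: n w => [|n IHn] [|[ts] g] //.
rewrite weight_cons ltnS /= in_cons /=; apply/mapP/idP.
  by case=> -[f h] /=; rewrite mem_filter /= => /andP[le_n _] [-> ->].
move=> le_n; exists (ts, g) => //; rewrite mem_filter le_n /=.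
apply: allpairs_f; rewrite IHn; apply: leq_trans le_n.
  exact: leq_addr.
exact: leq_addl.
Qed.

Lemma forests_upto_uniq (n : nat) : uniq (forests_upto n).
Proof.
elim: n => [|n IHn] //=; apply/andP; split; first by apply/mapP => -[].
rewrite map_inj_uniq => [|[f g] [f' g'] /= [-> ->] //].
by rewrite filter_uniq //; apply: allpairs_uniq => // -[? ?] [? ?].
Qed.

(* All the results of applying the multivalued map [f] to one entry of [l]. *)
Definition leibniz (T : Type) (f : T -> seq T) : seq T -> seq (seq T) :=
  fix lb l :=
    if l is x :: l' then
      [seq y :: l' | y <- f x] ++ [seq x :: m | m <- lb l']
    else [::].

(* The trees t o_s w, for s ranging over the nodes of w. *)
Fixpoint lgraft (t w : tree) : seq tree :=
  let: Node ts := w in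
  Node (t :: ts) :: [seq Node us | us <- leibniz (lgraft t) ts].

(* The terms of the coshuffle coproduct of w, the morphism to the tensor square
   given by t |-> t (x) 1 + 1 (x) t on trees. *)
Fixpoint unshuffles (w : forest) : seq (forest * forest) :=
  if w is t :: w' then
    [seq (t :: p.1, p.2) | p <- unshuffles w'] ++
    [seq (p.1, t :: p.2) | p <- unshuffles w']
  else [:: ([::], [::])].

Section Groups.
Variables (T : Type) (G : set T).

Definition is_group (e : T) (m : T -> T -> T) : Prop :=
  [/\ G e,
      forall a b, G a -> G b -> G (m a b),
      forall a b c, G a -> G b -> G c -> m a (m b c) = m (m a b) c,
      forall a, G a -> m e a = a /\ m a e = a
    & forall a, G a -> exists2 b, G b & m a b = e /\ m b a = e].

Definition is_automorphism (m : T -> T -> T) (f : T -> T) : Prop :=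
  [/\ forall b, G b -> G (f b),
      forall b c, G b -> G c -> f (m b c) = m (f b) (f c),
      forall b c, G b -> G c -> f b = f c -> b = c
    & forall c, G c -> exists2 b, G b & f b = c].

Definition is_post_group (e : T) (m r : T -> T -> T) : Prop :=
  [/\ is_group e m,
      forall a, G a -> is_automorphism m (r a)
    & forall a b c, G a -> G b -> G c -> r (m a (r a b)) c = r a (r b c)].

End Groups.

Section Algebra.
Variable k : fieldType.

Local Notation A := {malg k[forest]}.

Definition linext (K : choiceType) (V : lmodType k) (h : K -> V)
  (x : {malg k[K]}) : V := \sum_(u <- msupp x) x@_u *: h u.

Definition letter (t : tree) : A := << ([:: t] : forest) >>.

(* The free Lie algebra on PT, as the Lie subalgebra of its universal
   enveloping algebra k<PT> generated by PT. *)
Inductive Lie : A -> Prop :=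
| Lie_letter t : Lie (letter t)
| Lie_add x y : Lie x -> Lie y -> Lie (x + y)
| Lie_scale (c : k) x : Lie x -> Lie (c *: x)
| Lie_bracket x y : Lie x -> Lie y -> Lie (x * y - y * x).

(* The action (t_1 ... t_n) |> a of a word on a tree, given by
   (t . t_1 ... t_n) |> a = t |> ((t_1 ... t_n) |> a)
     - sum over i of (t_1 ... (t |> t_i) ... t_n) |> a.
   This is the rule defining |> on the enveloping algebra of a post-Lie algebra,
   taken at generators; as both sides are multilinear, these values determine
   |> on words acting on k{PT}. The recursion is on the length of the word. *)
Fixpoint act_rec (n : nat) (w : forest) (a : tree) : {malg k[tree]} :=
  match n, w with
  | n'.+1, t :: w' =>
      linext (fun b => \sum_(c <- lgraft t b) << c >>) (act_rec n' w' a)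
      - \sum_(v <- leibniz (lgraft t) w') act_rec n' v a
  | _, _ => << a >>
  end.

Definition act (w : forest) (a : tree) : A :=
  linext letter (act_rec (size w) w a).

(* u |> (a_1 ... a_m) = sum of (u_(1) |> a_1) ... (u_(m) |> a_m); for m = 0
   this is the counit of u. *)
Fixpoint word_tri (u v : forest) : A :=
  if v is a :: v' then
    \sum_(p <- unshuffles u) act p.1 a * word_tri p.2 v'
  else (u == [::])%:R.

Definition tri (X Y : A) : A :=
  linext (fun u => linext (word_tri u) Y) X.

Definition star (X Y : A) : A :=
  linext (fun u : forest =>
    \sum_(p <- unshuffles u) << p.1 >> * tri << p.2 >> Y) X.

Definition cosh (X : A) : {malg k[(forest * forest)%type]} :=
  linext (fun u => \sum_(p <- unshuffles u) << p >>) X.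

(* There are finitely many forests of each weight, so an element of the
   completion is an arbitrary family of coefficients. *)
Definition series : Type := forest -> k.

Definition trunc (n : nat) (f : series) : A :=
  \sum_(u <- forests_upto n) f u *: << u >>.

Definition homog (n : nat) (f : series) : A :=
  \sum_(u <- forests_upto n | weight u == n) f u *: << u >>.

(* Continuous extension of a bilinear operation of k<PT> which is additive for
   the weight: the coefficient of w only involves weights up to that of w. *)
Definition complete2 (op : A -> A -> A) (f g : series) : series :=
  fun w => (op (trunc (weight w) f) (trunc (weight w) g))@_w.

Definition sone : series := fun w => (w == [::])%:R.
Definition smul : series -> series -> series := complete2 *%R.
Definition stri : series -> series -> series := complete2 tri.
Definition sstar : series -> series -> series := complete2 star.

Definition scosh (f : series) (p : forest * forest) : k :=
  (cosh (trunc (weight p.1 + weight p.2) f))@_p.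

Definition group_like : set series :=
  [set g | (forall u v, scosh g (u, v) = g u * g v) /\ g [::] = 1].

(* The product over n >= 1 of the homogeneous components of the free Lie
   algebra. *)
Definition Lie_hat : set series :=
  [set x | x [::] = 0 /\ forall n, (0 < n)%N -> Lie (homog n x)].

(* The sums below are truncated: x, g - 1 and L are meant to increase the
   weight by at least 1, so that the terms of index n > weight w do not
   contribute to the coefficient of w. *)

Definition spow (op : series -> series -> series) (x : series) (n : nat) :
  series := iter n (op x) sone.

Definition sexp (x : series) : series :=
  fun w => \sum_(0 <= n < (weight w).+1) n`!%:R^-1 * spow smul x n w.

Definition slog (op : series -> series -> series) (g : series) : series :=
  fun w => \sum_(1 <= n < (weight w).+1)
    (-1) ^+ n.+1 / n%:R * spow op (fun u => g u - sone u) n w.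

Definition exp_op (L : series -> series) (y : series) : series :=
  fun w => \sum_(0 <= n < (weight w).+1) n`!%:R^-1 * iter n L y w.

Definition BCH (x y : series) : series := slog smul (smul (sexp x) (sexp y)).

Definition Omega (x : series) : series := slog sstar (sexp x).

End Algebra.

Arguments sone {k}.
Arguments group_like k : clear implicits.
Arguments Lie_hat k : clear implicits.

(* Main.v *)
(* Every series is determined by its truncations, so all identities are proved in
   k<PT> up to terms of large weight. The heart is the algebra of [tri] and
   [star]: for a tree t and a word w, (t w) |> v = t |> (w |> v) - (t |> w) |> v,
   and likewise (t w) * v = t * (w * v) - (t |> w) * v. Induction on the length
   of words then gives (X * Y) |> Z = X |> (Y |> Z) and the associativity of
   [star]; moreover the coshuffle coproduct is a morphism for concatenation and
   for |>.
   Hence a group-like g acts by g |> - as a morphism for concatenation, and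
   g * y = g . (g |> y). As exp x is the [star]-exponential of Omega x, the
   action of exp x is exp (L_(Omega x)), which gives
   exp x |> exp y = exp (exp x |> y) = exp (exp (L_(Omega x)) y).
   That group-like elements are the exponentials of primitive ones is the usual
   argument, log and exp being applied in the tensor square, and primitive
   elements are Lie elements by Dynkin's argument: dynkin * id, a convolution, is
   multiplication by the weight. *)
From HB Require Import structures.
Require Import Defs.
From mathcomp Require Import all_boot all_order all_algebra.
From mathcomp Require Import finmap monalg ring.
From mathcomp Require Import boolp classical_sets.

Set Implicit Arguments.
Unset Strict Implicit.
Unset Printing Implicit Defensive.

Import GRing.Theory.

Local Open Scope ring_scope.

(** * Linear extension and sums over unshufflings *)

(** Three products need exponentials and logarithms: concatenation, [star] and the product of the
    tensor square. None is commutative, but the relations between exp and log involve the powers of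
    a single element only; they are proved once, for truncated polynomials over [k], by comparing
    derivatives, and then evaluated in any filtered algebra. Bijectivity of [g |> -] on group-like
    elements and inverses for [star] need a separate argument. The [star]-inverse of [g] is a
    geometric series, which is not visibly group-like. It does invert the action of [g], so that
    group-likeness can be pulled back through an injective action on the tensor square; the
    [star]-inverse is then recognized as [sinv g |> h], with [h] the inverse of [g] for
    concatenation. The grading is by nodes, so a homogeneous component mixes words of different
    lengths. The usual Dynkin operator, whose convolution with the identity multiplies a word by its
    length, has no single eigenvalue there; weighting trees by their nodes restores one. *)

Section LinearExtension.
Variables (k : fieldType) (K : choiceType).
Implicit Types X Y : {malg k[K]}.

Lemma linextEw (V : lmodType k) (h : K -> V) (d : {fset K}) X :
  (msupp X `<=` d)%fset -> linext h X = \sum_(u <- d) X@_u *: h u.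
Proof.
move=> sXd; rewrite /linext (big_fset_incl _ sXd) // => u _ /mcoeff_outdom ->.
by rewrite scale0r.
Qed.

(* Locked, as unification problems between [<< u >>] and [0] or [1] are costly. *)
Definition mbase (u : K) : {malg k[K]} := locked << u >>.

Lemma mbaseE u : mbase u = << u >>.
Proof. by rewrite /mbase -lock. Qed.

Lemma linext_is_linear (V : lmodType k) (h : K -> V) : linear (linext h).
Proof.
move=> c X Y; pose d := (msupp X `|` msupp Y)%fset.
rewrite (@linextEw _ h d X) ?fsubsetUl // (@linextEw _ h d Y) ?fsubsetUr //.
rewrite (@linextEw _ h d) => [|]; last first.
  apply: (fsubset_trans (msuppD_le _ _)); apply: fsetSU; exact: msuppZ_le.
rewrite scaler_sumr -big_split /=; apply: eq_bigr => u _.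
by rewrite mcoeffD mcoeffZ scalerDl scalerA.
Qed.

HB.instance Definition _ (V : lmodType k) (h : K -> V) :=
  GRing.isLinear.Build k {malg k[K]} V *:%R (linext h) (linext_is_linear h).

Lemma linextU (V : lmodType k) (h : K -> V) u : linext h (mbase u) = h u.
Proof.
rewrite mbaseE (@linextEw _ h [fset u]%fset) ?msuppU_le // big_seq_fset1 mcoeffUU.
by rewrite scale1r.
Qed.

Lemma malgEsum X : X = \sum_(u <- msupp X) X@_u *: mbase u.
Proof.
rewrite {1}(monalgE X); apply: eq_bigr => u _.
by apply/malgP => v; rewrite mbaseE mcoeffZ !mcoeffU mulrnAr mulr1.
Qed.

Lemma malg_lin_ind (P : {malg k[K]} -> Prop) :
    P 0 -> (forall c X Y, P X -> P Y -> P (c *: X + Y)) ->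
    (forall u, P (mbase u)) -> forall X, P X.
Proof.
move=> P0 Plin PU X; rewrite (malgEsum X).
by elim: (enum_fset _) => [|u s IHs]; rewrite ?big_nil ?big_cons //; apply: Plin.
Qed.

Lemma eq_linear_malg (V : lmodType k) (f g : {malg k[K]} -> V) :
  linear f -> linear g -> (forall u, f (mbase u) = g (mbase u)) -> f =1 g.
Proof.
move=> lf lg efg X.
have f0 : f 0 = 0 by have:= lf (-1) 0 0; rewrite scaler0 addr0 scaleN1r addNr.
have g0 : g 0 = 0 by have:= lg (-1) 0 0; rewrite scaler0 addr0 scaleN1r addNr.
elim/malg_lin_ind: X => [|c X Y fX fY|u]; rewrite ?f0 ?g0 //.
by rewrite lf lg fX fY.
Qed.

Lemma eq_linext (V : lmodType k) (h1 h2 : K -> V) :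
  h1 =1 h2 -> linext h1 =1 linext h2.
Proof. by move=> eh X; apply: eq_bigr => u _; rewrite eh. Qed.

Lemma linext_linear (V : lmodType k) (I : lmodType k) (h : K -> I -> V) X :
  (forall u, linear (h u)) -> linear (fun y => linext (h^~ y) X).
Proof.
move=> lh c y z; rewrite /linext scaler_sumr -big_split; apply: eq_bigr => u _ /=.
by rewrite lh scalerDr !scalerA mulrC.
Qed.

End LinearExtension.

Section BilinearExtension.
Variables (k : fieldType) (K L : choiceType) (V : lmodType k) (h : K -> L -> V).
Implicit Types (X : {malg k[K]}) (Y : {malg k[L]}).

Definition bilext X Y : V := linext (fun u => linext (h u) Y) X.

Lemma bilext_linearl c X X' Y :
  bilext (c *: X + X') Y = c *: bilext X Y + bilext X' Y.
Proof. exact: linearP. Qed.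

Lemma bilext_is_linear X : linear (bilext X).
Proof. by apply: linext_linear => u c Y Y'; rewrite linearP. Qed.

HB.instance Definition _ X :=
  GRing.isLinear.Build k {malg k[L]} V *:%R (bilext X) (bilext_is_linear X).

Lemma bilext_linearr c X Y Y' :
  bilext X (c *: Y + Y') = c *: bilext X Y + bilext X Y'.
Proof. exact: bilext_is_linear. Qed.

Lemma bilext_suml (I : Type) (s : seq I) (F : I -> {malg k[K]}) Y :
  bilext (\sum_(i <- s) F i) Y = \sum_(i <- s) bilext (F i) Y.
Proof. by rewrite /bilext linear_sum. Qed.

Lemma bilext0l Y : bilext 0 Y = 0.
Proof. by rewrite /bilext linear0. Qed.

Lemma bilextU u v : bilext (mbase k u) (mbase k v) = h u v.
Proof. by rewrite /bilext !linextU. Qed.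

End BilinearExtension.

Section BigOnSequences.
Variable V : nmodType.

Lemma big_leibniz_nil (T : Type) (f : T -> seq T) (F : seq T -> V) :
  \sum_(m <- leibniz f [::]) F m = 0.
Proof. exact: big_nil. Qed.

Lemma big_leibniz_cons (T : Type) (f : T -> seq T) x l (F : seq T -> V) :
  \sum_(m <- leibniz f (x :: l)) F m
  = \sum_(y <- f x) F (y :: l) + \sum_(m <- leibniz f l) F (x :: m).
Proof. by rewrite /= big_cat !big_map. Qed.

Lemma big_unshuffles_nil (F : forest * forest -> V) :
  \sum_(p <- unshuffles [::]) F p = F ([::], [::]).
Proof. exact: big_seq1. Qed.

Lemma big_unshuffles_cons t (w : forest) (F : forest * forest -> V) :
  \sum_(p <- unshuffles (t :: w)) F p
  = \sum_(p <- unshuffles w) F (t :: p.1, p.2)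
    + \sum_(p <- unshuffles w) F (p.1, t :: p.2).
Proof. by rewrite /= big_cat !big_map. Qed.

Lemma big_unshuffles1 t (F : forest * forest -> V) :
  \sum_(p <- unshuffles [:: t]) F p = F ([:: t], [::]) + F ([::], [:: t]).
Proof. by rewrite !big_cons big_nil addr0. Qed.

(** Coassociativity, tested against an arbitrary [F] in place of a triple tensor product. The
    generality of [F] also drives the induction: a new letter joins one of three words, and [F]
    absorbs it. *)
Lemma unshuffles_coassoc w (F : forest -> forest -> forest -> V) :
  \sum_(p <- unshuffles w) \sum_(q <- unshuffles p.1) F q.1 q.2 p.2
  = \sum_(p <- unshuffles w) \sum_(q <- unshuffles p.2) F p.1 q.1 q.2.
Proof.
elim: w F => [|t w IHw] F; first by rewrite !big_unshuffles_nil.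
rewrite !big_unshuffles_cons /=.
under eq_bigr do rewrite big_unshuffles_cons.
under [X in _ = _ + X]eq_bigr do rewrite big_unshuffles_cons.
rewrite !big_split /= (IHw (fun a b c => F (t :: a) b c)).
rewrite (IHw (fun a b c => F a (t :: b) c)) (IHw (fun a b c => F a b (t :: c))).
by rewrite addrA.
Qed.

Lemma unshuffles_cocomm w (F : forest -> forest -> V) :
  \sum_(p <- unshuffles w) F p.1 p.2 = \sum_(p <- unshuffles w) F p.2 p.1.
Proof.
elim: w F => [|t w IHw] F; first by rewrite !big_unshuffles_nil.
rewrite !big_unshuffles_cons /= (IHw (fun a b => F (t :: a) b)).
by rewrite (IHw (fun a b => F a (t :: b))) addrC.
Qed.

(** By coassociativity the first two factors are the halves of one unshuffling, which
    cocommutativity swaps. *)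
Lemma unshuffles_coassocC w (F : forest -> forest -> forest -> V) :
  \sum_(p <- unshuffles w) \sum_(q <- unshuffles p.2) F p.1 q.1 q.2
  = \sum_(p <- unshuffles w) \sum_(q <- unshuffles p.2) F q.1 p.1 q.2.
Proof.
rewrite -unshuffles_coassoc -(unshuffles_coassoc _ (fun a b => F b a)).
apply: eq_bigr => p _; exact: (unshuffles_cocomm _ (fun a b => F a b p.2)).
Qed.

Lemma unshuffles_cat u v (F : forest -> forest -> V) :
  \sum_(p <- unshuffles (u ++ v)) F p.1 p.2
  = \sum_(p <- unshuffles u) \sum_(q <- unshuffles v) F (p.1 ++ q.1) (p.2 ++ q.2).
Proof.
elim: u F => [|t u IHu] F; first by rewrite big_unshuffles_nil.
rewrite cat_cons !big_unshuffles_cons /= (IHu (fun a b => F (t :: a) b)).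
by rewrite (IHu (fun a b => F a (t :: b))).
Qed.

(** [leibniz f] is a coderivation for the coshuffle coproduct: it replaces a letter by letters,
    which stay on the same side of the unshuffling. *)
Lemma unshuffles_leibniz (f : tree -> seq tree) (w : forest)
    (F : forest -> forest -> V) :
  \sum_(m <- leibniz f w) \sum_(p <- unshuffles m) F p.1 p.2
  = \sum_(p <- unshuffles w) (\sum_(m <- leibniz f p.1) F m p.2
                              + \sum_(m <- leibniz f p.2) F p.1 m).
Proof.
elim: w F => [|t w IHw] F.
  by rewrite big_leibniz_nil big_unshuffles_nil !big_leibniz_nil addr0.
rewrite big_leibniz_cons big_unshuffles_cons /=.
under eq_bigr do rewrite big_unshuffles_cons.
under [X in _ + X = _]eq_bigr do rewrite big_unshuffles_cons.
under [X in _ = X + _]eq_bigr do rewrite big_leibniz_cons.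
under [X in _ = _ + X]eq_bigr do rewrite big_leibniz_cons.
rewrite !big_split /= (IHw (fun a b => F (t :: a) b)).
rewrite (IHw (fun a b => F a (t :: b))) !big_split /=.
rewrite exchange_big [X in _ + X + _ = _]exchange_big /=.
rewrite -!addrA; congr (_ + _).
by do 2![rewrite addrCA; congr (_ + _)]; rewrite addrCA.
Qed.

End BigOnSequences.

Section MonoidAlgebra.
Variables (k : fieldType) (M : monomType).

Lemma malgU_mul (u v : M) :
  mbase k u * mbase k v = mbase k (mmul u v).
Proof. by rewrite !mbaseE malgM_def fgmulUU mulr1. Qed.

Lemma malg_scalerAr c (X Y : {malg k[M]}) : c *: (X * Y) = X * (c *: Y).
Proof.
suff malgC_comm (Z : {malg k[M]}) : Z * malgC c = malgC c * Z.
  by rewrite -!mul_malgC !mulrA malgC_comm.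
rewrite !malgM_def fgmulUg fgmulgU; apply: eq_bigr => u _.
by rewrite mulrC mulm1 mul1m.
Qed.

Lemma malg_mulE (X Y : {malg k[M]}) :
  X * Y = bilext (fun u v => mbase k (mmul u v)) X Y.
Proof.
elim/malg_lin_ind: X => [|c X1 X2 IX1 IX2|u]; first by rewrite mul0r bilext0l.
  by rewrite bilext_linearl mulrDl -scalerAl IX1 IX2.
elim/malg_lin_ind: Y => [|c X1 X2 IX1 IX2|v]; first by rewrite mulr0 linear0.
  by rewrite bilext_linearr mulrDr -malg_scalerAr IX1 IX2.
by rewrite bilextU malgU_mul.
Qed.

End MonoidAlgebra.

(** * The operations on words *)

(** Serves [star_cons], where [e] is the inclusion of words, [T] the action on a fixed element and
    [d] the grafting of [t]. Applying [d] to [conv u] also differentiates the factors [e p.1]. The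
    sum over [leibniz f u] splits by [unshuffles_leibniz]: one half removes this surplus, the other
    is the correction in [T (t :: v)]. *)
Lemma convolution_cons (B : pzRingType) (t : tree) (f : tree -> seq tree)
    (d : B -> B) (e T : forest -> B) u :
    (forall v, e (t :: v) = e [:: t] * e v) ->
    (forall x y, d (x * y) = d x * y + x * d y) ->
    (forall (I : Type) (s : seq I) (F : I -> B),
       d (\sum_(i <- s) F i) = \sum_(i <- s) d (F i)) ->
    (forall v, d (e v) = \sum_(m <- leibniz f v) e m) ->
    (forall v, T (t :: v) = d (T v) - \sum_(m <- leibniz f v) T m) ->
  let conv v := \sum_(p <- unshuffles v) e p.1 * T p.2 in
  conv (t :: u) = e [:: t] * conv u + d (conv u) - \sum_(m <- leibniz f u) conv m.
Proof.
move=> e_cons dM d_sum d_e T_cons /=; rewrite big_unshuffles_cons /=.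
rewrite (unshuffles_leibniz _ _ (fun p q => e p * T q)) d_sum mulr_sumr.
rewrite -addrA -sumrB; congr (_ + _); apply: eq_bigr => p _.
  by rewrite e_cons mulrA.
rewrite T_cons dM d_e mulrBr mulr_suml mulr_sumr opprD addrACA subrr.
by rewrite add0r.
Qed.

Section WordOperations.
Variable k : fieldType.
Local Notation A := {malg k[forest]}.
Local Notation word u := (mbase k (u : forest)).
Implicit Types (t : tree) (u v w : forest) (X Y Z : A).

Lemma malgMU u v : word u * word v = word (u ++ v) :> A.
Proof. exact: malgU_mul. Qed.

Lemma malg1E : 1 = word [::] :> A.
Proof. by rewrite mbaseE. Qed.

Lemma letterE t : letter k t = word [:: t].
Proof. by rewrite mbaseE. Qed.

Lemma unshuffles_counitl (V : lmodType k) w (F : forest -> forest -> V) :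
  \sum_(p <- unshuffles w) (p.1 == [::])%:R *: F p.1 p.2 = F [::] w.
Proof.
elim: w F => [|t w IHw] F; first by rewrite big_unshuffles_nil scale1r.
rewrite big_unshuffles_cons /= big1 => [|p _]; last by rewrite scale0r.
by rewrite add0r (IHw (fun a b => F a (t :: b))).
Qed.

Lemma unshuffles_counitr (V : lmodType k) w (F : forest -> forest -> V) :
  \sum_(p <- unshuffles w) (p.2 == [::])%:R *: F p.1 p.2 = F w [::].
Proof.
rewrite -(unshuffles_counitl w (fun a b => F b a)).
exact: (unshuffles_cocomm w (fun a b => (b == [::])%:R *: F a b)).
Qed.

Lemma tri_linearl c X X' Y : tri (c *: X + X') Y = c *: tri X Y + tri X' Y.
Proof. by rewrite /tri linearP. Qed.

Lemma tri_is_linear X : linear (tri X).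
Proof. by apply: linext_linear => u c Y Y'; rewrite linearP. Qed.

HB.instance Definition _ X :=
  GRing.isLinear.Build k A A *:%R (tri X) (tri_is_linear X).

Lemma tri_linearr c X Y Y' : tri X (c *: Y + Y') = c *: tri X Y + tri X Y'.
Proof. exact: tri_is_linear. Qed.

Lemma tri0l Y : tri 0 Y = 0.
Proof. by rewrite /tri linear0. Qed.

Lemma tri_suml (I : Type) (s : seq I) (F : I -> A) Y :
  tri (\sum_(i <- s) F i) Y = \sum_(i <- s) tri (F i) Y.
Proof. by rewrite /tri linear_sum. Qed.

Lemma triU u v : tri (word u) (word v) = word_tri k u v.
Proof. by rewrite /tri !linextU. Qed.

Lemma star_linearl c X X' Y : star (c *: X + X') Y = c *: star X Y + star X' Y.
Proof. by rewrite /star linearP. Qed.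

Lemma star_is_linear X : linear (star X).
Proof.
apply: linext_linear => u c Y Y'; rewrite scaler_sumr -big_split.
by apply: eq_bigr => p _; rewrite linearP mulrDr malg_scalerAr.
Qed.

HB.instance Definition _ X :=
  GRing.isLinear.Build k A A *:%R (star X) (star_is_linear X).

Lemma star0l Y : star 0 Y = 0.
Proof. by rewrite /star linear0. Qed.

Lemma star_suml (I : Type) (s : seq I) (F : I -> A) Y :
  star (\sum_(i <- s) F i) Y = \sum_(i <- s) star (F i) Y.
Proof. by rewrite /star linear_sum. Qed.

Lemma starU u Y :
  star (word u) Y = \sum_(p <- unshuffles u) word p.1 * tri (word p.2) Y.
Proof. by rewrite /star linextU; apply: eq_bigr => p _; rewrite !mbaseE. Qed.

(** The derivation of concatenation that extends left grafting of [t]; [tri_letter] identifies it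
    with the action of the letter [t]. *)
Definition grow t : A -> A :=
  linext (fun v : forest => \sum_(m <- leibniz (lgraft t) v) word m).

HB.instance Definition _ t := GRing.Linear.on (grow t).

Lemma grow_linear t c X Y : grow t (c *: X + Y) = c *: grow t X + grow t Y.
Proof. exact: linearP. Qed.

Lemma growU t v : grow t (word v) = \sum_(m <- leibniz (lgraft t) v) word m.
Proof. by rewrite /grow linextU. Qed.

Lemma word_cons t v : word [:: t] * word v = word (t :: v).
Proof. exact: malgMU. Qed.

Lemma grow_derivation t X Y : grow t (X * Y) = grow t X * Y + X * grow t Y.
Proof.
elim/malg_lin_ind: X Y => [Y|c X X' IX IX' Y|u Y].
- by rewrite !(mul0r, linear0, addr0).
- rewrite mulrDl -scalerAl !grow_linear IX IX' !mulrDl -!scalerAl scalerDr.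
  by rewrite addrACA.
elim/malg_lin_ind: Y => [|c Y Y' IY IY'|v].
- by rewrite !(mulr0, linear0, addr0).
- rewrite mulrDr -malg_scalerAr !grow_linear IY IY' !mulrDr -!malg_scalerAr.
  by rewrite scalerDr addrACA.
rewrite malgMU !growU; elim: u => [|a u IHu].
  by rewrite big_leibniz_nil -malg1E mul0r add0r mul1r.
have sum_cons l : \sum_(m <- l) word (a :: m)
    = word [:: a] * \sum_(m <- l) word m :> A.
  by rewrite mulr_sumr; apply: eq_bigr => m _; rewrite word_cons.
have sum_cat l : \sum_(y <- l) word (y :: (u ++ v))
    = (\sum_(y <- l) word (y :: u)) * word v :> A.
  by rewrite mulr_suml; apply: eq_bigr => m _; rewrite malgMU.
rewrite cat_cons !big_leibniz_cons !sum_cons sum_cat IHu -(word_cons a u).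
by rewrite mulrDr [in RHS]mulrDl !mulrA addrA.
Qed.

Lemma size_leibniz (T : eqType) (f : T -> seq T) (l m : seq T) :
  m \in leibniz f l -> size m = size l.
Proof.
elim: l m => [|x l IHl] m //=; rewrite mem_cat => /orP[] /mapP[y my ->] //=.
by rewrite (IHl _ my).
Qed.

Lemma act_nil a : act k [::] a = word [:: a].
Proof. by rewrite /act /= -mbaseE linextU letterE. Qed.

Lemma actE w a : act k w a = linext (fun t => word [:: t]) (act_rec k (size w) w a).
Proof. by apply: eq_linext => t; rewrite letterE. Qed.

Lemma act_cons t w a :
  act k (t :: w) a
  = grow t (act k w a) - \sum_(v <- leibniz (lgraft t) w) act k v a.
Proof.
rewrite !actE /= linearB /=; congr (_ - _); last first.
  (* The fuel of [act_rec] is the length of the word, which [leibniz] preserves. *)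
  rewrite linear_sum big_seq [RHS]big_seq; apply: eq_bigr => v /size_leibniz eq_sz.
  by rewrite actE eq_sz.
elim/malg_lin_ind: (act_rec _ _ _ _) => [|c X Y IX IY|b]; first by rewrite !linear0.
  by rewrite !linearP /= IX IY.
rewrite !linextU linear_sum growU big_leibniz_cons big_leibniz_nil addr0.
by apply: eq_bigr => c _; rewrite -mbaseE [LHS]linextU.
Qed.

Lemma word_tri_nil v : word_tri k [::] v = word v.
Proof.
by elim: v => [|a v IHv] /=; rewrite ?malg1E // big_unshuffles_nil act_nil IHv word_cons.
Qed.

Lemma tri1X Y : tri 1 Y = Y.
Proof.
elim/malg_lin_ind: Y => [|c X Y IX IY|v]; first by rewrite linear0.
  by rewrite tri_linearr IX IY.
by rewrite malg1E triU word_tri_nil.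
Qed.

Lemma tri_word_letter u a : tri (word u) (word [:: a]) = act k u a.
Proof.
rewrite triU /= -(unshuffles_counitr u (fun v _ => act k v a)).
apply: eq_bigr => p _.
by case: (_ == _); rewrite ?scale0r ?mulr0 ?scale1r ?mulr1.
Qed.

Lemma word_tri_letter t v : word_tri k [:: t] v = grow t (word v).
Proof.
rewrite growU; elim: v => [|a v IHv] //=; first by rewrite big_nil.
rewrite !big_cons big_nil addr0 /= word_tri_nil IHv act_cons big_leibniz_nil subr0.
rewrite act_nil growU !big_leibniz_cons big_leibniz_nil addr0 mulr_suml mulr_sumr.
by congr (_ + _); apply: eq_bigr => m _; rewrite malgMU.
Qed.

Lemma tri_letter t Y : tri (word [:: t]) Y = grow t Y.
Proof.
apply: (eq_linear_malg (tri_is_linear _) (grow_linear t)) => v.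
by rewrite triU word_tri_letter.
Qed.

(** The recursion imposed by [act_cons] on a single tree passes to [v] letter by letter: [grow t] is
    a derivation of concatenation, and [leibniz] is compatible with the coproduct that distributes
    the acting word. *)
Lemma tri_consU t w v :
  tri (word (t :: w)) (word v)
  = grow t (tri (word w) (word v)) - tri (grow t (word w)) (word v).
Proof.
rewrite growU tri_suml; under eq_bigr do rewrite triU.
rewrite !triU; elim: v t w => [|a v IHv] t w.
  (* On the empty word [tri] is the counit. Both sides vanish, as [grow t] kills 1 and preserves the
     length of the other words. *)
  case: w => [|b w].
    by rewrite big_leibniz_nil word_tri_nil growU big_leibniz_nil subrr.
  rewrite /= linear0 big_seq big1 ?subrr // => m.
  by move/(@size_leibniz _ _ (b :: w)); case: m.
rewrite [LHS]/= big_unshuffles_cons /=.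
under eq_bigr do rewrite act_cons mulrBl.
under [X in _ + X]eq_bigr do rewrite IHv mulrBr.
rewrite !big_split /= !sumrN addrACA -opprD; congr (_ - _).
  rewrite linear_sum -big_split; apply: eq_bigr => p _.
  by rewrite /= grow_derivation.
rewrite (unshuffles_leibniz _ _ (fun p q => act k p a * word_tri k q v)).
rewrite big_split /=; congr (_ + _); apply: eq_bigr => p _; first by rewrite mulr_suml.
by rewrite mulr_sumr.
Qed.

Lemma tri_cons t X Y :
  tri (word [:: t] * X) Y = grow t (tri X Y) - tri (grow t X) Y.
Proof.
elim/malg_lin_ind: X Y => [Y|c X X' IX IX' Y|u Y].
- by rewrite mulr0 linear0 tri0l linear0 subr0.
- rewrite mulrDr -malg_scalerAr !(tri_linearl, grow_linear) IX IX' scalerBr.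
  by rewrite opprD addrACA.
elim/malg_lin_ind: Y => [|c Y Y' IY IY'|v].
- by rewrite !linear0 addr0.
- by rewrite !(tri_linearr, grow_linear) IY IY' scalerBr opprD addrACA.
by rewrite word_cons tri_consU.
Qed.

Lemma tri1_word u : tri (word u) 1 = (u == [::])%:R :> A.
Proof. by rewrite [X in tri _ X]malg1E triU. Qed.

(** The definition of [tri] peels one letter at a time off the right argument; coassociativity
    extends the rule to an arbitrary left factor. *)
Lemma triMr u X Y :
  tri (word u) (X * Y) = \sum_(p <- unshuffles u) tri (word p.1) X * tri (word p.2) Y.
Proof.
elim/malg_lin_ind: X Y u => [Y u|c X X' IX IX' Y u|v Y u].
- by rewrite mul0r linear0 big1 // => p _; rewrite linear0 mul0r.
- rewrite mulrDl -scalerAl tri_linearr IX IX' scaler_sumr -big_split.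
  by apply: eq_bigr => p _; rewrite tri_linearr mulrDl scalerAl.
elim: v Y u => [|a v IHv] Y u.
  rewrite -malg1E mul1r -(unshuffles_counitl u (fun _ b => tri (word b) Y)).
  apply: eq_bigr => p _; rewrite tri1_word.
  by case: (_ == _); rewrite ?scale0r ?mul0r ?scale1r ?mul1r.
have tri_letterM Z w : tri (word w) (word [:: a] * Z)
    = \sum_(p <- unshuffles w) act k p.1 a * tri (word p.2) Z.
  elim/malg_lin_ind: Z => [|c Z Z' IZ IZ'|z].
  - by rewrite mulr0 linear0 big1 // => p _; rewrite linear0 mulr0.
  - rewrite mulrDr -malg_scalerAr tri_linearr IZ IZ' scaler_sumr -big_split.
    by apply: eq_bigr => p _; rewrite tri_linearr mulrDr malg_scalerAr.
  by rewrite word_cons triU; apply: eq_bigr => p _; rewrite triU.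
rewrite -word_cons -mulrA tri_letterM.
under [RHS]eq_bigr do rewrite tri_letterM mulr_suml.
rewrite (unshuffles_coassoc u
  (fun a' b c => act k a' a * tri (word b) (word v) * tri (word c) Y)).
apply: eq_bigr => p _; rewrite IHv mulr_sumr.
by apply: eq_bigr => q _; rewrite mulrA.
Qed.

Lemma letter_starE t Y : star (word [:: t]) Y = word [:: t] * Y + grow t Y.
Proof.
by rewrite starU big_unshuffles1 /= -malg1E tri1X tri_letter mul1r.
Qed.

Lemma star1X Y : star 1 Y = Y.
Proof. by rewrite {1}malg1E starU big_unshuffles_nil /= -malg1E tri1X mul1r. Qed.

Lemma starX1 X : star X 1 = X.
Proof.
elim/malg_lin_ind: X => [|c X X' IX IX'|u]; first by rewrite star0l.
  by rewrite star_linearl IX IX'.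
rewrite starU -(unshuffles_counitr u (fun a _ => word a)).
apply: eq_bigr => p _; rewrite tri1_word.
by case: (_ == _); rewrite ?scale0r ?mulr0 ?scale1r ?mulr1.
Qed.

Lemma star_cons t X Y :
  star (word [:: t] * X) Y
  = word [:: t] * star X Y + grow t (star X Y) - star (grow t X) Y.
Proof.
elim/malg_lin_ind: X => [|c X X' IX IX'|u].
- by rewrite !(mulr0, linear0, star0l) !addr0.
- rewrite mulrDr -malg_scalerAr !(star_linearl, grow_linear) IX IX' mulrDr.
  rewrite -malg_scalerAr scalerBr scalerDr opprD addrACA; congr (_ + _).
  by rewrite addrACA.
rewrite word_cons growU star_suml; under eq_bigr do rewrite starU.
rewrite !starU.
apply: (convolution_cons (e := fun v => word v) (T := fun v => tri (word v) Y)).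
- by move=> v; rewrite word_cons.
- exact: grow_derivation.
- by move=> I s F; rewrite linear_sum.
- by move=> v; rewrite growU.
- by move=> v; rewrite -word_cons tri_cons growU tri_suml.
Qed.

(* As [letter t * X = star (letter t) X - grow t X], the third hypothesis is the
   conclusion for a letter; [grow t] preserves the length of words, which allows
   an induction on it. *)
Lemma star_action (op : A -> A -> A) :
    (forall c X X' Y, op (c *: X + X') Y = c *: op X Y + op X' Y) ->
    (forall Y, op 1 Y = Y) ->
    (forall t X Y,
       op (word [:: t] * X) Y = op (word [:: t]) (op X Y) - op (grow t X) Y) ->
  forall X Y Z, op (star X Y) Z = op X (op Y Z).
Proof.
move=> op_lin op1 op_cons X Y Z.
have opD X1 X2 : op (X1 + X2) Z = op X1 Z + op X2 Z.
  by rewrite -{1}[X1]scale1r op_lin scale1r.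
have op0 W : op 0 W = 0.
  by have:= op_lin (-1) 0 0 W; rewrite scaler0 addr0 scaleN1r addNr.
have opN X1 : op (- X1) Z = - op X1 Z.
  by rewrite -scaleN1r -{1}[_ *: X1]addr0 op_lin op0 addr0 scaleN1r.
have op_sum (s : seq forest) (F : forest -> A) W :
    op (\sum_(m <- s) F m) W = \sum_(m <- s) op (F m) W.
  elim: s => [|m s IHs]; rewrite ?big_nil ?big_cons //.
  by rewrite -{1}[F m]scale1r op_lin IHs scale1r.
elim/malg_lin_ind: X => [|c X X' IX IX'|u]; first by rewrite star0l !op0.
  by rewrite star_linearl !op_lin IX IX'.
have [n le_u_n] := ubnP (size u); elim: n u le_u_n => // n IHn [|t w] /=.
  by rewrite -malg1E star1X op1.
rewrite ltnS => lt_w_n; rewrite -word_cons star_cons op_cons -IHn //.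
(* The term [grow t (star (word w) Y)] of [star_cons] cancels against the correction that [op_cons]
   produces for the product by the letter. *)
rewrite opD opD opN op_cons subrK; congr (_ - _).
rewrite growU star_suml !op_sum big_seq [RHS]big_seq; apply: eq_bigr => m.
by move=> /size_leibniz sz_m; rewrite IHn // sz_m.
Qed.

Lemma tri_star X Y Z : tri (star X Y) Z = tri X (tri Y Z).
Proof.
apply: star_action => [c X1 X2 W|W|t X1 W]; first exact: tri_linearl.
  exact: tri1X.
by rewrite tri_cons tri_letter.
Qed.

Lemma starA X Y Z : star (star X Y) Z = star X (star Y Z).
Proof.
apply: star_action => [c X1 X2 W|W|t X1 W]; first exact: star_linearl.
  exact: star1X.
by rewrite star_cons letter_starE.
Qed.

End WordOperations.

(** * The tensor square *)

Section ProductMonoid.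
Variables M N : monomType.

Definition pair_one : M * N := (mone, mone).
Definition pair_mul (p q : M * N) : M * N := (mmul p.1 q.1, mmul p.2 q.2).

Lemma pair_mulA : associative pair_mul.
Proof. by move=> p q r; rewrite /pair_mul /= !mulmA. Qed.

Lemma pair_mul1 : left_id pair_one pair_mul.
Proof. by case=> u v; rewrite /pair_mul /= !mul1m. Qed.

Lemma pair_mulr1 : right_id pair_one pair_mul.
Proof. by case=> u v; rewrite /pair_mul /= !mulm1. Qed.

Lemma pair_unitm p q : pair_mul p q = pair_one -> p = pair_one /\ q = pair_one.
Proof.
by case: p q => [u v] [u' v'] [] /unitm[-> ->] /unitm[-> ->].
Qed.

HB.instance Definition _ := Choice_isMonomialDef.Build (M * N)%type
  pair_mulA pair_mul1 pair_mulr1 pair_unitm.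

End ProductMonoid.

Section TensorSquare.
Variable k : fieldType.
Local Notation A := {malg k[forest]}.
(* The tensor square of A, thanks to the product monoid above. *)
Local Notation AA := {malg k[(forest * forest)%type]}.
Local Notation word u := (mbase k (u : forest)).
Local Notation word2 u v := (mbase k (u : forest, v : forest)).
Implicit Types (t : tree) (u v w : forest) (X Y Z : A).

Definition tens X : A -> AA := locked (bilext (fun u v => word2 u v) X).

Lemma tensE X : tens X = bilext (fun u v => word2 u v) X.
Proof. by rewrite /tens -lock. Qed.

Lemma tensU u v : tens (word u) (word v) = word2 u v.
Proof. by rewrite tensE bilextU. Qed.

Lemma tens_is_linear X : linear (tens X).
Proof. by rewrite tensE; apply: bilext_is_linear. Qed.

HB.instance Definition _ X :=
  GRing.isLinear.Build k A AA *:%R (tens X) (tens_is_linear X).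

Lemma tens_linearr c X Y Y' : tens X (c *: Y + Y') = c *: tens X Y + tens X Y'.
Proof. exact: tens_is_linear. Qed.

Lemma tens_linearl c X X' Y : tens (c *: X + X') Y = c *: tens X Y + tens X' Y.
Proof. by rewrite !tensE bilext_linearl. Qed.

Lemma tens0l Y : tens 0 Y = 0.
Proof. by rewrite tensE bilext0l. Qed.

Lemma tens_suml (I : Type) (s : seq I) (F : I -> A) Y :
  tens (\sum_(i <- s) F i) Y = \sum_(i <- s) tens (F i) Y.
Proof.
by rewrite tensE bilext_suml; apply: eq_bigr => i _; rewrite tensE.
Qed.

Lemma word2M u v u' v' : word2 u v * word2 u' v' = word2 (u ++ u') (v ++ v').
Proof. exact: malgU_mul. Qed.

Lemma word2_1 : 1 = word2 [::] [::] :> AA.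
Proof. by rewrite mbaseE. Qed.

Lemma tens11 : tens 1 1 = 1.
Proof. by rewrite malg1E tensU word2_1. Qed.

Lemma tensM X Y X' Y' : tens X Y * tens X' Y' = tens (X * X') (Y * Y').
Proof.
elim/malg_lin_ind: X => [|c X1 X2 IX1 IX2|u].
- by rewrite mul0r !tens0l mul0r.
- by rewrite mulrDl -scalerAl !tens_linearl mulrDl -scalerAl IX1 IX2.
elim/malg_lin_ind: X' => [|c X1 X2 IX1 IX2|u'].
- by rewrite mulr0 !tens0l mulr0.
- by rewrite mulrDr -malg_scalerAr !tens_linearl mulrDr -malg_scalerAr IX1 IX2.
elim/malg_lin_ind: Y => [|c X1 X2 IX1 IX2|v].
- by rewrite mul0r !linear0 mul0r.
- by rewrite mulrDl -scalerAl !tens_linearr mulrDl -scalerAl IX1 IX2.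
elim/malg_lin_ind: Y' => [|c X1 X2 IX1 IX2|v'].
- by rewrite mulr0 !linear0 mulr0.
- by rewrite mulrDr -malg_scalerAr !tens_linearr mulrDr -malg_scalerAr IX1 IX2.
by rewrite !tensU !malgMU word2M tensU.
Qed.

HB.instance Definition _ :=
  GRing.isLinear.Build k A AA *:%R (@cosh k) (linext_is_linear _).

Lemma cosh_linear c X Y : cosh (c *: X + Y) = c *: cosh X + cosh Y.
Proof. exact: linearP. Qed.

Lemma coshU u : cosh (word u) = \sum_(p <- unshuffles u) word2 p.1 p.2.
Proof.
by rewrite /cosh linextU; apply: eq_bigr => -[v w] _; rewrite mbaseE.
Qed.

Lemma cosh1 : cosh 1 = 1 :> AA.
Proof. by rewrite malg1E coshU big_unshuffles_nil word2_1. Qed.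

Lemma coshM X Y : cosh (X * Y) = cosh X * cosh Y.
Proof.
elim/malg_lin_ind: X => [|c X1 X2 IX1 IX2|u].
- by rewrite mul0r !linear0 mul0r.
- by rewrite mulrDl -scalerAl !cosh_linear mulrDl -scalerAl IX1 IX2.
elim/malg_lin_ind: Y => [|c X1 X2 IX1 IX2|v].
- by rewrite mulr0 !linear0 mulr0.
- by rewrite mulrDr -malg_scalerAr !cosh_linear mulrDr -malg_scalerAr IX1 IX2.
rewrite malgMU !coshU (unshuffles_cat _ _ (fun a b => word2 a b)) mulr_suml.
apply: eq_bigr => p _; rewrite mulr_sumr; apply: eq_bigr => q _.
by rewrite word2M.
Qed.

(** Meant for [act k u a]: a word sends a tree to a combination of trees, which is primitive. *)
Lemma cosh_letters (Y : {malg k[tree]}) :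
  let X := linext (fun t => word [:: t]) Y in cosh X = tens X 1 + tens 1 X.
Proof.
move=> /=; elim/malg_lin_ind: Y => [|c Y1 Y2 IY1 IY2|t].
- by rewrite !linear0 tens0l addr0.
- rewrite linearP /= !(cosh_linear, tens_linearl, tens_linearr) IY1 IY2.
  by rewrite scalerDr addrACA.
by rewrite linextU coshU big_unshuffles1 malg1E !tensU.
Qed.

(** The action of the tensor square on itself, factor by factor; with it [cosh] becomes a morphism
    for [tri] ([cosh_tri]). *)
Definition tri2 (P : AA) : AA -> AA := locked (bilext (fun p q : forest * forest =>
  tens (tri (word p.1) (word q.1)) (tri (word p.2) (word q.2))) P).

Lemma tri2E P : tri2 P = bilext (fun p q : forest * forest =>
  tens (tri (word p.1) (word q.1)) (tri (word p.2) (word q.2))) P.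
Proof. by rewrite /tri2 -lock. Qed.

Lemma tri2U u v u' v' : tri2 (word2 u v) (word2 u' v')
  = tens (tri (word u) (word u')) (tri (word v) (word v')).
Proof. by rewrite tri2E bilextU. Qed.

Lemma tri2_is_linear P : linear (tri2 P).
Proof. by rewrite tri2E; apply: bilext_is_linear. Qed.

HB.instance Definition _ P :=
  GRing.isLinear.Build k AA AA *:%R (tri2 P) (tri2_is_linear P).

Lemma tri2_linearr c P Q Q' : tri2 P (c *: Q + Q') = c *: tri2 P Q + tri2 P Q'.
Proof. exact: tri2_is_linear. Qed.

Lemma tri2_linearl c P P' Q : tri2 (c *: P + P') Q = c *: tri2 P Q + tri2 P' Q.
Proof. by rewrite !tri2E bilext_linearl. Qed.

Lemma tri20l Q : tri2 0 Q = 0.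
Proof. by rewrite tri2E bilext0l. Qed.

Lemma tri2_suml (I : Type) (s : seq I) (F : I -> AA) Q :
  tri2 (\sum_(i <- s) F i) Q = \sum_(i <- s) tri2 (F i) Q.
Proof.
by rewrite tri2E bilext_suml; apply: eq_bigr => i _; rewrite tri2E.
Qed.

Lemma tri2_tens X Y X' Y' : tri2 (tens X Y) (tens X' Y') = tens (tri X X') (tri Y Y').
Proof.
elim/malg_lin_ind: X => [|c X1 X2 IX1 IX2|u].
- by rewrite tens0l tri20l tri0l tens0l.
- by rewrite !(tens_linearl, tri2_linearl, tri_linearl) IX1 IX2.
elim/malg_lin_ind: X' => [|c X1 X2 IX1 IX2|u'].
- by rewrite tens0l !linear0 tens0l.
- by rewrite tri_linearr !tens_linearl tri2_linearr IX1 IX2.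
elim/malg_lin_ind: Y => [|c X1 X2 IX1 IX2|v].
- by rewrite linear0 tri20l tri0l linear0.
- by rewrite tri_linearl !tens_linearr tri2_linearl IX1 IX2.
elim/malg_lin_ind: Y' => [|c X1 X2 IX1 IX2|v'].
- by rewrite !linear0.
- by rewrite tri_linearr !tens_linearr tri2_linearr IX1 IX2.
by rewrite !tensU tri2U.
Qed.

(** The image of the first letter [a] of the right-hand word is primitive, so every term splits in
    two according to the tensor factor that receives it. Regrouping the parts of [u] takes
    coassociativity in the first case, and cocommutativity as well in the second. *)
Lemma cosh_triU u v :
  cosh (tri (word u) (word v)) = \sum_(p <- unshuffles u) \sum_(q <- unshuffles v)
    tens (tri (word p.1) (word q.1)) (tri (word p.2) (word q.2)).
Proof.
elim: v u => [|a v IHv] u.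
  rewrite -malg1E tri1_word; under eq_bigr do
    rewrite big_unshuffles_nil /= -malg1E !tri1_word.
  transitivity (\sum_(p <- unshuffles u)
      (p.1 == [::])%:R *: tens 1 (p.2 == [::])%:R); last first.
    by apply: eq_bigr => p _; case: (p.1 == _); rewrite ?scale1r // scale0r tens0l.
  rewrite (unshuffles_counitl u (fun _ b => tens 1 (b == [::])%:R)).
  by case: (u == _); rewrite ?linear0 // cosh1 tens11.
rewrite -word_cons triMr linear_sum /=.
transitivity (\sum_(p <- unshuffles u) \sum_(r <- unshuffles p.2)
    \sum_(q <- unshuffles v)
      (tens (tri (word p.1) (word [:: a]) * tri (word r.1) (word q.1))
            (tri (word r.2) (word q.2))
     + tens (tri (word r.1) (word q.1))
            (tri (word p.1) (word [:: a]) * tri (word r.2) (word q.2)))).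
  apply: eq_bigr => p _; rewrite coshM IHv mulr_sumr; apply: eq_bigr => r _.
  rewrite mulr_sumr; apply: eq_bigr => q _.
  rewrite tri_word_letter actE cosh_letters -actE.
  by rewrite mulrDl !tensM !mul1r.
under [RHS]eq_bigr do rewrite big_unshuffles_cons.
rewrite big_split /=.
under eq_bigr do (under eq_bigr do rewrite big_split /=; rewrite big_split /=).
rewrite big_split /=; congr (_ + _).
  pose F b c d := \sum_(q <- unshuffles v)
    tens (tri (word b) (word [:: a]) * tri (word c) (word q.1))
         (tri (word d) (word q.2)).
  rewrite -[LHS]/(\sum_(p <- unshuffles u) \sum_(r <- unshuffles p.2)
    F p.1 r.1 r.2) -unshuffles_coassoc; apply: eq_bigr => p _.
  rewrite /F exchange_big; apply: eq_bigr => q _ /=.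
  by rewrite -(word_cons k a q.1) triMr tens_suml.
pose F b c d := \sum_(q <- unshuffles v)
  tens (tri (word b) (word q.1))
       (tri (word c) (word [:: a]) * tri (word d) (word q.2)).
rewrite -[LHS]/(\sum_(p <- unshuffles u) \sum_(r <- unshuffles p.2)
  F r.1 p.1 r.2) -(unshuffles_coassocC u F); apply: eq_bigr => p _.
rewrite /F exchange_big; apply: eq_bigr => q _ /=.
by rewrite -(word_cons k a q.2) triMr linear_sum.
Qed.

Lemma cosh_tri X Y : cosh (tri X Y) = tri2 (cosh X) (cosh Y).
Proof.
elim/malg_lin_ind: X => [|c X1 X2 IX1 IX2|u].
- by rewrite tri0l !linear0 tri20l.
- by rewrite !(tri_linearl, cosh_linear, tri2_linearl) IX1 IX2.
elim/malg_lin_ind: Y => [|c X1 X2 IX1 IX2|v].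
- by rewrite !linear0.
- by rewrite tri_linearr !cosh_linear tri2_linearr IX1 IX2.
rewrite cosh_triU !coshU tri2_suml; apply: eq_bigr => p _.
by rewrite linear_sum; apply: eq_bigr => q _; rewrite /= tri2U.
Qed.

(** Makes the dependence on [X] factor through [cosh X], so that a congruence between [cosh X] and
    [tens X X] can be substituted. [tri_mul_cosh] has the same purpose. *)
Lemma star_cosh X Y :
  star X Y = linext (fun p : forest * forest => word p.1 * tri (word p.2) Y) (cosh X).
Proof.
elim/malg_lin_ind: X => [|c X1 X2 IX1 IX2|u].
- by rewrite star0l !linear0.
- by rewrite star_linearl cosh_linear linearP IX1 IX2.
rewrite starU coshU linear_sum; apply: eq_bigr => p _.
by rewrite [RHS]linextU.
Qed.

Lemma tri_mul_cosh X Y Z :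
  tri X (Y * Z)
  = linext (fun p : forest * forest => tri (word p.1) Y * tri (word p.2) Z) (cosh X).
Proof.
elim/malg_lin_ind: X => [|c X1 X2 IX1 IX2|u].
- by rewrite tri0l !linear0.
- by rewrite tri_linearl cosh_linear linearP IX1 IX2.
rewrite triMr coshU linear_sum; apply: eq_bigr => p _.
by rewrite [RHS]linextU.
Qed.

End TensorSquare.

(** * The weight filtration *)

Section Filtration.
Variables (k : fieldType) (K : choiceType) (wt : K -> nat).
Implicit Types X Y : {malg k[K]}.

(** The weight is a parameter, to cover trees ([nodes]), words ([weight]) and pairs of words
    ([weight2]). *)
Definition ord_ge n X := forall u, (wt u < n)%N -> X@_u = 0.

Lemma ord_ge_lin n c X Y : ord_ge n X -> ord_ge n Y -> ord_ge n (c *: X + Y).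
Proof.
by move=> oX oY u lt_u; rewrite mcoeffD mcoeffZ oX // oY // mulr0 addr0.
Qed.

Lemma ord_ge_all X : ord_ge 0 X.
Proof. by []. Qed.

Lemma ord_ge0 n : ord_ge n 0.
Proof. by move=> u _; rewrite mcoeff0. Qed.

Lemma ord_geZ n c X : ord_ge n X -> ord_ge n (c *: X).
Proof. by move=> oX; rewrite -[_ *: _]addr0; apply: ord_ge_lin; last exact: ord_ge0. Qed.

Lemma ord_geD n X Y : ord_ge n X -> ord_ge n Y -> ord_ge n (X + Y).
Proof. by move=> oX oY; rewrite -[X]scale1r; apply: ord_ge_lin. Qed.

Lemma ord_geN n X : ord_ge n X -> ord_ge n (- X).
Proof. by rewrite -scaleN1r; apply: ord_geZ. Qed.

Lemma ord_geB n X Y : ord_ge n X -> ord_ge n Y -> ord_ge n (X - Y).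
Proof. by move=> oX oY; apply: ord_geD => //; apply: ord_geN. Qed.

Lemma ord_ge_sum n (I : eqType) (s : seq I) (F : I -> {malg k[K]}) :
  (forall i, i \in s -> ord_ge n (F i)) -> ord_ge n (\sum_(i <- s) F i).
Proof.
move=> oF; rewrite big_seq; elim/big_ind: _ => [||i /oF] //; first exact: ord_ge0.
exact: ord_geD.
Qed.

Lemma ord_geW m n X : (m <= n)%N -> ord_ge n X -> ord_ge m X.
Proof. by move=> le_mn oX u lt_um; apply/oX/(leq_trans lt_um). Qed.

Lemma ord_ge_base n u : (n <= wt u)%N -> ord_ge n (mbase k u).
Proof.
move=> le_nu v lt_vn; rewrite mbaseE mcoeffU; case: eqP => // eq_uv.
by rewrite -eq_uv ltnNge le_nu in lt_vn.
Qed.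

Definition eqm n X Y := forall u, (wt u <= n)%N -> X@_u = Y@_u.

Lemma eqmP n X Y : eqm n X Y <-> ord_ge n.+1 (X - Y).
Proof.
split=> eXY u; first by rewrite ltnS => /eXY eu; rewrite mcoeffB eu subrr.
by rewrite -ltnS => /eXY /eqP; rewrite mcoeffB subr_eq0 => /eqP.
Qed.

Lemma eqm_refl n X : eqm n X X. Proof. by []. Qed.

Lemma eqm_sym n X Y : eqm n X Y -> eqm n Y X.
Proof. by move=> eXY u /eXY ->. Qed.

Lemma eqm_trans n Y X Z : eqm n X Y -> eqm n Y Z -> eqm n X Z.
Proof. by move=> eXY eYZ u le_u; rewrite eXY // eYZ. Qed.

Lemma eqm_lin n c X X' Y Y' :
  eqm n X X' -> eqm n Y Y' -> eqm n (c *: X + Y) (c *: X' + Y').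
Proof. by move=> eX eY u le_u; rewrite !mcoeffD !mcoeffZ eX // eY. Qed.

Lemma eqmD n X X' Y Y' : eqm n X X' -> eqm n Y Y' -> eqm n (X + Y) (X' + Y').
Proof. by move=> eX eY u le_u; rewrite !mcoeffD eX // eY. Qed.

Lemma eqmB n X X' Y Y' : eqm n X X' -> eqm n Y Y' -> eqm n (X - Y) (X' - Y').
Proof. by move=> eX eY u le_u; rewrite !mcoeffB eX // eY. Qed.

Lemma eqmZ n c X X' : eqm n X X' -> eqm n (c *: X) (c *: X').
Proof. by move=> eX u le_u; rewrite !mcoeffZ eX. Qed.

Lemma eqm_sum n (I : Type) (s : seq I) (F F' : I -> {malg k[K]}) :
  (forall i, eqm n (F i) (F' i)) -> eqm n (\sum_(i <- s) F i) (\sum_(i <- s) F' i).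
Proof. by move=> eF; elim/big_ind2: _ => // *; apply: eqmD. Qed.

End Filtration.

Section FilteredLinear.
Variables (k : fieldType) (K L : choiceType) (wK : K -> nat) (wL : L -> nat).

Lemma ord_ge_linext m n (h : K -> {malg k[L]}) X :
    (forall u, (n <= wK u)%N -> ord_ge wL m (h u)) ->
  ord_ge wK n X -> ord_ge wL m (linext h X).
Proof.
move=> oh oX; apply: ord_ge_sum => u _.
have [le_nu|lt_un] := leqP n (wK u); first exact/ord_geZ/oh.
by rewrite oX // scale0r; apply: ord_ge0.
Qed.

Lemma eqm_linext n (h : K -> {malg k[L]}) X X' :
    (forall u, ord_ge wL (wK u) (h u)) ->
  eqm wK n X X' -> eqm wL n (linext h X) (linext h X').
Proof.
move=> oh /eqmP eX; apply/eqmP; rewrite -linearB; apply: ord_ge_linext eX => u le_u.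
exact: ord_geW (oh u).
Qed.

End FilteredLinear.

Section FilteredBilinear.
Variables (k : fieldType) (K L M : choiceType).
Variables (wK : K -> nat) (wL : L -> nat) (wM : M -> nat).

Lemma ord_ge_bilext (h : K -> L -> {malg k[M]}) m n X Y :
    (forall u v, ord_ge wM (wK u + wL v) (h u v)) ->
  ord_ge wK m X -> ord_ge wL n Y -> ord_ge wM (m + n) (bilext h X Y).
Proof.
move=> oh oX oY; apply: ord_ge_linext oX => u le_mu.
apply: ord_ge_linext oY => v le_nv; apply: ord_geW (oh u v).
exact: leq_add.
Qed.

(** The arguments are replaced one at a time; each error is [op] applied to one element of order
    above [n] and one of order at least 0. *)
Lemma eqm_bilinear n (op : {malg k[K]} -> {malg k[L]} -> {malg k[M]}) X X' Y Y' :
    (forall X, linear (op X)) ->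
    (forall c X X' Y, op (c *: X + X') Y = c *: op X Y + op X' Y) ->
    (forall m n X Y, ord_ge wK m X -> ord_ge wL n Y -> ord_ge wM (m + n) (op X Y)) ->
  eqm wK n X X' -> eqm wL n Y Y' -> eqm wM n (op X Y) (op X' Y').
Proof.
move=> lopr lopl oop /eqmP eX /eqmP eY.
apply: (@eqm_trans _ _ _ _ (op X Y')).
  have := oop 0 n.+1 X (Y - Y') (ord_ge_all _) eY; rewrite add0n => oXY; apply/eqmP.
  by congr ord_ge: oXY; rewrite addrC -scaleN1r lopr scaleN1r addrC.
have := oop n.+1 0 (X - X') Y' eX (ord_ge_all _); rewrite addn0 => oXY; apply/eqmP.
by congr ord_ge: oXY; rewrite addrC -scaleN1r lopl scaleN1r addrC.
Qed.

End FilteredBilinear.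

Section WeightedOperations.
Variable k : fieldType.
Local Notation A := {malg k[forest]}.
Local Notation AA := {malg k[(forest * forest)%type]}.
Local Notation word u := (mbase k (u : forest)).
Local Notation word2 u v := (mbase k (u : forest, v : forest)).
Local Notation ordA := (@ord_ge k forest weight).

Definition weight2 (p : forest * forest) := (weight p.1 + weight p.2)%N.

Local Notation ordAA := (@ord_ge k (forest * forest)%type weight2).
Implicit Types (t : tree) (u v w : forest) (X Y Z : A).

Lemma weight_cat u v : weight (u ++ v) = (weight u + weight v)%N.
Proof. by rewrite /weight map_cat sumn_cat. Qed.

Lemma weight_tcons t u : weight (t :: u) = (nodes t + weight u)%N.
Proof. by []. Qed.

Lemma ordA_mul m n X Y : ordA m X -> ordA n Y -> ordA (m + n) (X * Y).
Proof.
rewrite malg_mulE; apply: ord_ge_bilext => u v; apply: ord_ge_base.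
by rewrite weight_cat.
Qed.

Lemma ordAA_mul m n (P Q : AA) : ordAA m P -> ordAA n Q -> ordAA (m + n) (P * Q).
Proof.
rewrite malg_mulE; apply: ord_ge_bilext => p q; apply: ord_ge_base.
by rewrite /weight2 /= !weight_cat addnACA.
Qed.

Lemma ordAA_tens m n X Y : ordA m X -> ordA n Y -> ordAA (m + n) (tens X Y).
Proof. by rewrite tensE; apply: ord_ge_bilext => u v; apply: ord_ge_base. Qed.

Lemma weight_leibniz c (f : tree -> seq tree) w :
    (forall t s, t \in w -> s \in f t -> nodes s = (c + nodes t)%N) ->
  forall m, m \in leibniz f w -> weight m = (c + weight w)%N.
Proof.
elim: w => // t w IHw wf m; rewrite mem_cat => /orP[] /mapP[s s_f ->] /=.
  by rewrite !weight_tcons (wf t) ?mem_head // addnA.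
rewrite !weight_tcons IHw // 1?addnCA // => t' s' t'w; apply: wf.
by rewrite inE t'w orbT.
Qed.

Lemma nodes_lgraft t s c : c \in lgraft t s -> nodes c = (nodes t + nodes s)%N.
Proof.
(* Induction on a bound for the number of nodes, which covers every subtree in the list [ss]. *)
elim: (nodes s).+1 {-2}s (leqnn (nodes s).+1) c => // n IHn [ss] le_s c.
rewrite inE => /orP[/eqP-> //=|/mapP[us us_l ->]]; first by rewrite addnS.
have := @weight_leibniz (nodes t) (lgraft t) ss _ us us_l.
rewrite /weight /= => -> => [|b d b_ss]; first by rewrite addnS.
apply: IHn; rewrite -ltnS; apply: leq_trans le_s; rewrite /= !ltnS sumnE big_map.
by rewrite (big_rem b) //= leq_addr.
Qed.

Lemma ord_act_rec n w a : size w = n ->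
  ord_ge nodes (weight w + nodes a) (act_rec k n w a).
Proof.
elim: n w a => [|n IHn] [|t w] a //= => [_|[sz_w]].
  by rewrite -mbaseE; apply: ord_ge_base.
apply: ord_geB.
  apply: ord_ge_linext (IHn _ _ sz_w) => b le_b; apply: ord_ge_sum => c c_l.
  rewrite -mbaseE; apply: ord_ge_base.
  by rewrite (nodes_lgraft c_l) weight_tcons -addnA leq_add2l.
apply: ord_ge_sum => v v_l; have sz_v := size_leibniz v_l.
have <- : weight v = weight (t :: w); last by apply: IHn; rewrite sz_v.
by apply: weight_leibniz v_l => b c _; apply: nodes_lgraft.
Qed.

Lemma ord_act w a : ordA (weight w + nodes a) (act k w a).
Proof.
rewrite actE; apply: ord_ge_linext (@ord_act_rec _ w a erefl) => b le_b.
by apply: ord_ge_base; rewrite /weight /= addn0.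
Qed.

Lemma weight_unshuffles w p : p \in unshuffles w -> weight2 p = weight w.
Proof.
elim: w p => [|t w IHw] p /=; first by rewrite inE => /eqP->.
rewrite mem_cat => /orP[] /mapP[q /IHw + ->]; rewrite /weight2 !weight_tcons => <- /=.
  by rewrite addnA.
by rewrite addnCA.
Qed.

Lemma ord_word_tri u v : ordA (weight u + weight v) (word_tri k u v).
Proof.
elim: v u => [|a v IHv] u /=.
  case: u => [|t u] /=; last exact: ord_ge0.
  by rewrite malg1E; apply: ord_ge_base.
apply: ord_ge_sum => p /weight_unshuffles <-.
rewrite weight_tcons /weight2 addnACA; apply: ordA_mul => //; exact: ord_act.
Qed.

Lemma ordA_tri m n X Y : ordA m X -> ordA n Y -> ordA (m + n) (tri X Y).
Proof. by apply: ord_ge_bilext; apply: ord_word_tri. Qed.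

Lemma ordAA_cosh u : ordAA (weight u) (\sum_(p <- unshuffles u) << p >>).
Proof.
apply: ord_ge_sum => p /weight_unshuffles <-.
by rewrite -mbaseE; apply: ord_ge_base.
Qed.

Lemma eqm_cosh n X Y : eqm weight n X Y -> eqm weight2 n (cosh X) (cosh Y).
Proof. by apply: eqm_linext; apply: ordAA_cosh. Qed.

Lemma ordA_star m n X Y : ordA m X -> ordA n Y -> ordA (m + n) (star X Y).
Proof.
move=> oX oY; apply: ord_ge_linext oX => u le_u.
apply: ord_ge_sum => p /weight_unshuffles eq_p; rewrite -!mbaseE.
apply: (@ord_geW _ _ _ _ (weight p.1 + (weight p.2 + n))).
  by rewrite addnA -/(weight2 p) eq_p leq_add2r.
by apply: ordA_mul; last apply: ordA_tri => //; apply: ord_ge_base.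
Qed.

Lemma ordAA_tri2 m n (P Q : AA) : ordAA m P -> ordAA n Q -> ordAA (m + n) (tri2 P Q).
Proof.
rewrite tri2E; apply: ord_ge_bilext => p q; rewrite /weight2 addnACA.
by apply: ordAA_tens; apply: ordA_tri; apply: ord_ge_base.
Qed.

End WeightedOperations.

(** * Truncated power series *)

Section PowerSeries.
Variable k : fieldType.
Hypothesis char0 : [pchar k] =i pred0.
Implicit Types p q : {poly k}.

Definition exp_coef i : k := i`!%:R^-1.
(* Its value at [0] is [0], as [0^-1 = 0]. *)
Definition log_coef i : k := (-1) ^+ i.+1 / i%:R.
(** The coefficients of the inverse of 1 + X, which is the derivative of log (1 + X). *)
Definition geo_coef i : k := (-1) ^+ i.
Definition ptrunc (c : nat -> k) n : {poly k} := \poly_(i < n.+1) c i.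

Lemma natrS_neq0 n : n.+1%:R != 0 :> k.
Proof. by move/pcharf0P: char0 => ->. Qed.

Lemma dvdX p : p`_0 = 0 -> exists q, p = 'X * q.
Proof.
move=> p0; exists (p %/ 'X); rewrite mulrC divpK //.
by rewrite -[X in X %| _]subr0 dvdp_XsubCl /root horner_coef0 p0.
Qed.

Lemma ptrunc_coef0 c n : (ptrunc c n)`_0 = c 0%N.
Proof. by rewrite coef_poly. Qed.

Lemma deriv_exp n :
  (ptrunc exp_coef n)^`() = ptrunc exp_coef n - exp_coef n *: 'X^n.
Proof.
apply/polyP => i; rewrite coef_deriv coefB coefZ coefXn !coef_poly !ltnS.
rewrite /exp_coef; case: (ltngtP i n) => [lt_in|gt_in|->].
- rewrite mulr0 subr0 factS -[_ *+ i.+1]mulr_natr natrM invfM mulrAC mulVf ?mul1r //.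
  exact: natrS_neq0.
- by rewrite mul0rn mulr0 subr0.
- by rewrite mul0rn mulr1 subrr.
Qed.

Lemma deriv_log n : (ptrunc log_coef n)^`() = \poly_(i < n) geo_coef i.
Proof.
apply/polyP => i; rewrite coef_deriv !coef_poly ltnS; case: ifP => _; last first.
  by rewrite mul0rn.
rewrite /log_coef -[_ *+ i.+1]mulr_natr mulfVK ?natrS_neq0 // !exprS !mulN1r opprK.
by rewrite /geo_coef.
Qed.

Lemma geometric_sum n : (1 + 'X) * \poly_(i < n) geo_coef i = 1 - (- 'X) ^+ n.
Proof.
have -> : \poly_(i < n) geo_coef i = \sum_(i < n) (- 'X) ^+ i :> {poly k}.
  rewrite poly_def; apply: eq_bigr => i _.
  by rewrite /geo_coef (exprNn 'X) -mul_polyC polyC_exp polyCN.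
by rewrite -opprB subrX1 -mulNr opprB opprK.
Qed.

(** In degree [j < n] the equation reads (j+1) d_(j+1) + j d_j = d_j, so d_j = 0 forces d_(j+1) = 0
    in characteristic zero. *)
Lemma ode_coef0 n (d q : {poly k}) : d`_0 = 0 ->
  (1 + 'X) * d^`() = d + 'X^n * q -> forall j, (j <= n)%N -> d`_j = 0.
Proof.
move=> d0 eq_d; elim=> [|j IHj] // lt_jn.
have := congr1 (fun p : {poly k} => p`_j) eq_d.
rewrite mulrDl mul1r !coefD coefXnM lt_jn addr0 coefXM !coef_deriv IHj 1?ltnW //.
have -> : (if j == 0 then 0 else d`_j.-1.+1 *+ j.-1.+1) = 0.
  by case: (j) IHj lt_jn => [|l] //= IHj lt_jn; rewrite IHj ?mul0rn // ltnW.
rewrite addr0 -mulr_natr => /eqP.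
by rewrite mulf_eq0 (negPf (natrS_neq0 _)) orbF => /eqP.
Qed.

Lemma deriv_coef0 n (d q : {poly k}) : d`_0 = 0 ->
  d^`() = 'X^n * q -> forall j, (j <= n)%N -> d`_j = 0.
Proof.
move=> d0 eq_d [|j] // lt_jn; have := congr1 (fun p : {poly k} => p`_j) eq_d.
rewrite coef_deriv coefXnM lt_jn -mulr_natr => /eqP.
by rewrite mulf_eq0 (negPf (natrS_neq0 _)) orbF => /eqP.
Qed.

(* Both sides satisfy the differential equation [(1 + X) f' = f] up to degree
   [n], with the same constant term. *)
Lemma comp_exp_log n i : (i <= n)%N ->
  (ptrunc exp_coef n \Po ptrunc log_coef n)`_i = (1 + 'X)`_i.
Proof.
set E := ptrunc exp_coef n; set L := ptrunc log_coef n; move=> le_in.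
pose d := E \Po L - (1 + 'X).
have L0 : L`_0 = 0 by rewrite ptrunc_coef0 /log_coef invr0 mulr0.
have d0 : d`_0 = 0.
  rewrite coefB -horner_coef0 horner_comp (horner_coef0 L) L0 horner_coef0.
  by rewrite ptrunc_coef0 /exp_coef invr1 coefD coefX coef1 addr0 subrr.
have [M eqL] := dvdX L0.
have [q eq_d] : exists q, (1 + 'X) * d^`() = d + 'X^n * q.
  rewrite /d derivB deriv_comp deriv_exp derivD derivX derivC add0r.
  rewrite mulrBr mulr1 mulrCA deriv_log geometric_sum.
  (* The truncation errors of [deriv_exp] and [geometric_sum]. The first is composed with [L], and
     stays divisible by ['X^n] because [L = 'X * M]. *)
  exists (- (exp_coef n *: M ^+ n) - (E \Po L - exp_coef n *: L ^+ n) * (-1) ^+ n).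
  rewrite comp_polyB comp_polyZ comp_Xn_poly -/E (exprNn 'X).
  have -> : L ^+ n = 'X^n * M ^+ n by rewrite eqL exprMn.
  by rewrite -!mul_polyC; ring.
by apply/eqP; rewrite -subr_eq0 -coefB (ode_coef0 d0 eq_d).
Qed.

(** With 1 + Z the exponential, the derivative of log (1 + Z) is Z' / (1 + Z) = 1 up to truncation
    errors divisible by X^n. The constant terms agree, and characteristic zero allows
    integration. *)
Lemma comp_log_exp n i : (i <= n)%N ->
  (ptrunc log_coef n \Po (ptrunc exp_coef n - 1))`_i = 'X`_i.
Proof.
set E := ptrunc exp_coef n; set L := ptrunc log_coef n; move=> le_in.
pose Z := E - 1; pose d := L \Po Z - 'X.
have Z0 : Z`_0 = 0 by rewrite coefB coef1 ptrunc_coef0 /exp_coef invr1 subrr.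
have d0 : d`_0 = 0.
  rewrite coefB -horner_coef0 horner_comp (horner_coef0 Z) Z0 horner_coef0.
  by rewrite ptrunc_coef0 /log_coef invr0 mulr0 coefX subrr.
have [M eqZ] := dvdX Z0.
have [q eq_d] : exists q, d^`() = 'X^n * q.
  rewrite /d derivB derivX deriv_comp deriv_log derivB derivC subr0 deriv_exp.
  set G := \poly_(i < n) _.
  have geoZ : (1 + Z) * (G \Po Z) = 1 - (- Z) ^+ n.
    have := congr1 (comp_poly Z) (geometric_sum n).
    rewrite rmorphM rmorphD rmorphB rmorphXn rmorphN /= comp_polyX.
    by rewrite -polyC1 comp_polyC.
  exists (- ((- M) ^+ n) - exp_coef n *: (G \Po Z)).
  rewrite -mul_polyC mulrBr -/E mulrC (_ : E = 1 + Z); last by rewrite addrC subrK.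
  rewrite geoZ (_ : (- Z) ^+ n = 'X^n * (- M) ^+ n); last by rewrite eqZ -mulrN exprMn.
  by rewrite -mul_polyC; ring.
by apply/eqP; rewrite -subr_eq0 -coefB (deriv_coef0 d0 eq_d).
Qed.

End PowerSeries.

(** * Filtered algebras *)

(* [{malg k[forest]}] has no canonical [algType] structure, as it is not
   commutative: hence the first clause. *)
Record filtered_algebra (k : fieldType) (B : lalgType k) (F : nat -> B -> Prop)
  : Prop := FilteredAlgebra {
  falg_scaler : forall (c : k) (x y : B), c *: (x * y) = x * (c *: y);
  falg_zero : forall n, F n 0;
  falg_lin : forall n c x y, F n x -> F n y -> F n (c *: x + y);
  falg_le : forall m n x, (m <= n)%N -> F n x -> F m x;
  falg_all : forall x, F 0 x;
  falg_mul : forall m n x y, F m x -> F n y -> F (m + n) (x * y)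
}.

Definition psum (k : fieldType) (B : lalgType k) (c : nat -> k) n (x : B) : B :=
  \sum_(i < n.+1) c i *: x ^+ i.

(** Regroups by total degree: on the left, binomial expansions of the powers of a sum; on the right,
    a Cauchy product cut at total degree [n]. *)
Lemma triangular_sum (V : nmodType) n (g : nat -> nat -> V) :
  \sum_(i < n.+1) \sum_(j < i.+1) g (i - j)%N j
  = \sum_(i < n.+1) \sum_(j < n.+1 | (i + j <= n)%N) g i j.
Proof.
under eq_bigr => i _ do rewrite (big_ord_widen n.+1 (fun j => g (i - j)%N j)) //.
rewrite (exchange_big_dep xpredT) //= [RHS](exchange_big_dep xpredT) //=.
apply: eq_bigr => j _; under eq_bigl do rewrite ltnS.
rewrite -(big_mkord (fun i => j <= i)%N (fun i => g (i - j)%N j)).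
rewrite -(big_nat_widenl j 0 n.+1 xpredT) // -{1}[j : nat]add0n big_addn.
rewrite big_mkord (big_ord_widen n.+1 (fun i => g (i + j - j)%N j)) ?leq_subr //.
by apply: eq_big => [i|i _]; rewrite ?addnK // ltn_subRL addnC.
Qed.

Section FilteredAlgebra.
Variables (k : fieldType) (B : lalgType k) (F : nat -> B -> Prop).
Hypothesis falgF : filtered_algebra F.
Hypothesis char0 : [pchar k] =i pred0.
Implicit Types (x y : B) (p q : {poly k}).

Lemma falg_sum n (I : Type) (s : seq I) (P : pred I) (f : I -> B) :
  (forall i, P i -> F n (f i)) -> F n (\sum_(i <- s | P i) f i).
Proof.
move=> Ff; elim/big_ind: _ => // [|x y Fx Fy]; first exact: falg_zero.
by rewrite -[x]scale1r; apply: falg_lin.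
Qed.

Lemma falgZ n c x : F n x -> F n (c *: x).
Proof. by move=> Fx; rewrite -[_ *: _]addr0; apply: falg_lin => //; apply: falg_zero. Qed.

Lemma falg_exp n x : F 1 x -> F n (x ^+ n).
Proof.
move=> Fx; elim: n => [|n IHn]; first exact: falg_all.
by rewrite exprS -add1n; apply: falg_mul.
Qed.

Lemma in_alg_commr x : commr_rmorph (in_alg B) x.
Proof.
by move=> c; rewrite /GRing.comm -(falg_scaler falgF) mulr1 mulr_algl.
Qed.

(** A ring morphism even for noncommutative [B], since it suffices that scalars commute with [x]; it
    carries polynomial identities into [B]. *)
Definition pev x : {poly k} -> B := horner_morph (in_alg_commr x).
HB.instance Definition _ x := GRing.RMorphism.on (pev x).

Lemma pevZ x c p : pev x (c *: p) = c *: pev x p.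
Proof. by rewrite -mul_polyC rmorphM /= /pev horner_morphC mulr_algl. Qed.

Lemma pevX x : pev x 'X = x.
Proof. exact: horner_morphX. Qed.

Lemma pev_ptrunc x c n : pev x (ptrunc c n) = psum c n x.
Proof.
rewrite /ptrunc poly_def rmorph_sum; apply: eq_bigr => i _.
by rewrite /= pevZ rmorphXn /= pevX.
Qed.

Lemma pev_comp x p q : pev (pev x q) p = pev x (p \Po q).
Proof.
elim/poly_ind: p => [|p c IHp]; first by rewrite comp_poly0 !rmorph0.
rewrite comp_polyD comp_polyM comp_polyX comp_polyC !rmorphD !rmorphM /= IHp pevX.
by rewrite /pev !horner_morphC.
Qed.

Lemma falg_pevXnM x n q : F 1 x -> F n (pev x ('X^n * q)).
Proof.
move=> Fx; rewrite rmorphM rmorphXn /= pevX -[n]addn0.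
by apply: falg_mul; rewrite ?addn0; [|exact: falg_exp|exact: falg_all].
Qed.

(** The bridge from polynomials to the filtration: an identity valid up to degree [n] becomes a
    congruence modulo [F n.+1]. *)
Lemma falg_pev x n p : F 1 x -> (forall i, (i <= n)%N -> p`_i = 0) -> F n.+1 (pev x p).
Proof.
move=> Fx p0; rewrite -(coefK p) poly_def rmorph_sum; apply: falg_sum => i _.
rewrite /= pevZ rmorphXn /= pevX; case: (leqP i n) => [/p0 ->|lt_ni].
  by rewrite scale0r; apply: falg_zero.
by apply: falgZ; apply: falg_le lt_ni _ => //; apply: falg_exp.
Qed.

Lemma psum_exp_log n x : F 1 x ->
  F n.+1 (psum (exp_coef k) n (psum (log_coef k) n x) - (1 + x)).
Proof.
move=> Fx; have -> : 1 + x = pev x (1 + 'X) by rewrite rmorphD rmorph1 /= pevX.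
rewrite -!pev_ptrunc pev_comp -rmorphB; apply: falg_pev => // i le_in.
by rewrite coefB comp_exp_log // subrr.
Qed.

Lemma psum_log_exp n x : F 1 x ->
  F n.+1 (psum (log_coef k) n (psum (exp_coef k) n x - 1) - x).
Proof.
move=> Fx; rewrite -[X in _ - X]pevX.
have -> : psum (exp_coef k) n x - 1 = pev x (ptrunc (exp_coef k) n - 1).
  by rewrite rmorphB rmorph1 /= pev_ptrunc.
rewrite -pev_ptrunc pev_comp -rmorphB; apply: falg_pev => // i le_in.
by rewrite coefB comp_log_exp // subrr.
Qed.

Lemma psum_geo n x : F 1 x -> F n.+1 ((1 + x) * psum (geo_coef k) n x - 1).
Proof.
move=> Fx; have -> : 1 + x = pev x (1 + 'X) by rewrite rmorphD rmorph1 /= pevX.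
rewrite -pev_ptrunc -rmorphM geometric_sum rmorphB rmorph1 addrC addKr.
rewrite (exprNn 'X) mulrC -rmorphN /= -mulrN; exact: falg_pevXnM.
Qed.

Lemma psum_geo_comm n x :
  psum (geo_coef k) n x * (1 + x) = (1 + x) * psum (geo_coef k) n x.
Proof.
have -> : 1 + x = pev x (1 + 'X) by rewrite rmorphD rmorph1 /= pevX.
by rewrite -pev_ptrunc -!rmorphM mulrC.
Qed.

Lemma falg_psum c n x : F 1 x -> c 0%N = 0 -> F 1 (psum c n x).
Proof.
move=> Fx c0; apply: falg_sum => -[[|i] /= _] _.
  by rewrite c0 scale0r; apply: falg_zero.
by apply: falgZ; apply: (falg_le falgF _ (falg_exp _ Fx)).
Qed.

Lemma psum_exp_add n x y : F 1 x -> F 1 y -> x * y = y * x ->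
  F n.+1 (psum (exp_coef k) n (x + y)
          - psum (exp_coef k) n x * psum (exp_coef k) n y).
Proof.
move=> Fx Fy cxy; pose g a b := (exp_coef k a * exp_coef k b) *: (x ^+ a * y ^+ b).
have -> : psum (exp_coef k) n (x + y) = \sum_(i < n.+1) \sum_(j < i.+1) g (i - j)%N j.
  apply: eq_bigr => i _; rewrite exprDn_comm // scaler_sumr; apply: eq_bigr => j _.
  rewrite -scaler_nat scalerA /g; congr (_ *: _).
  have le_ji : (j <= i)%N by rewrite -ltnS.
  rewrite /exp_coef -(bin_fact le_ji) !natrM !invfM mulrAC mulVf ?mul1r 1?mulrC //.
  by move/pcharf0P: char0 => ->; rewrite -lt0n bin_gt0.
have -> : psum (exp_coef k) n x * psum (exp_coef k) n y
    = \sum_(i < n.+1) \sum_(j < n.+1) g i j.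
  rewrite mulr_suml; apply: eq_bigr => i _; rewrite mulr_sumr; apply: eq_bigr => j _.
  by rewrite -scalerAl -(falg_scaler falgF) scalerA.
rewrite triangular_sum -sumrB; apply: falg_sum => i _.
(* The terms with [i + j <= n] cancel; the remaining ones lie in [F (i + j)], hence in [F n.+1]. *)
rewrite [X in _ - X](bigID (fun j : 'I_n.+1 => (i + j <= n)%N)) /= opprD addNKr.
rewrite -scaleN1r; apply: falgZ; apply: falg_sum => j; rewrite -ltnNge => lt_n.
by apply: falgZ; apply: (falg_le falgF lt_n); apply: falg_mul => //; apply: falg_exp.
Qed.

End FilteredAlgebra.

(** * Series and their approximations *)

(* A copy of k<PT> with [star] as multiplication. *)
Definition starred (k : fieldType) : Type := {malg k[forest]}.

Section StarredAlgebra.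
Variable k : fieldType.
Local Notation B := (starred k).

HB.instance Definition _ := GRing.Lmodule.on B.

Fact starred_mulA : associative (@star k : B -> B -> B).
Proof. by move=> X Y Z; rewrite starA. Qed.

Fact starred_mul1 : left_id (1 : {malg k[forest]}) (@star k : B -> B -> B).
Proof. exact: star1X. Qed.

Fact starred_mulr1 : right_id (1 : {malg k[forest]}) (@star k : B -> B -> B).
Proof. exact: starX1. Qed.

Fact starred_mulDl : left_distributive (@star k : B -> B -> B) +%R.
Proof. by move=> X Y Z; rewrite -[X in star (X + _)]scale1r star_linearl scale1r. Qed.

Fact starred_mulDr : right_distributive (@star k : B -> B -> B) +%R.
Proof. by move=> X Y Z; rewrite linearD. Qed.

Fact starred_1neq0 : (1 : {malg k[forest]}) != 0 :> B.
Proof. exact: oner_neq0. Qed.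

HB.instance Definition _ := GRing.Zmodule_isNzRing.Build B
  starred_mulA starred_mul1 starred_mulr1 starred_mulDl starred_mulDr starred_1neq0.

Fact starred_scalerAl (c : k) (x y : B) : c *: star x y = star (c *: x) y :> B.
Proof. by have := star_linearl c x 0 y; rewrite star0l !addr0 => ->. Qed.

HB.instance Definition _ := GRing.Lmodule_isLalgebra.Build k B starred_scalerAl.

Lemma starred_filtered : @filtered_algebra k B (@ord_ge k forest weight).
Proof.
split => [c x y|n|n c x y|m n x|x|m n x y].
- exact/esym/linearZ.
- exact: ord_ge0.
- exact: ord_ge_lin.
- exact: ord_geW.
- exact: ord_ge_all.
- exact: ordA_star.
Qed.

Lemma words_filtered : @filtered_algebra k {malg k[forest]} (@ord_ge k forest weight).
Proof.
split => [c x y|n|n c x y|m n x|x|m n x y].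
- exact: malg_scalerAr.
- exact: ord_ge0.
- exact: ord_ge_lin.
- exact: ord_geW.
- exact: ord_ge_all.
- exact: ordA_mul.
Qed.

Lemma tensor_filtered : @filtered_algebra k {malg k[(forest * forest)%type]}
  (@ord_ge k (forest * forest)%type weight2).
Proof.
split => [c x y|n|n c x y|m n x|x|m n x y].
- exact: malg_scalerAr.
- exact: ord_ge0.
- exact: ord_ge_lin.
- exact: ord_geW.
- exact: ord_ge_all.
- exact: ordAA_mul.
Qed.

End StarredAlgebra.

Section Series.
Variable k : fieldType.
Local Notation A := {malg k[forest]}.
Local Notation word u := (mbase k (u : forest)).
Local Notation ordA := (@ord_ge k forest weight).
Local Notation eqA := (@eqm k forest weight).
Implicit Types (f g x y : series k) (X Y Z G : A) (op : A -> A -> A).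

Definition approx n f X := forall u, (weight u <= n)%N -> f u = X@_u.

Lemma mcoeff_sum_words (s : seq forest) f v : uniq s ->
  (\sum_(u <- s) f u *: << u >> : A)@_v = f v *+ (v \in s).
Proof.
elim: s => [|u s IHs] /=; first by rewrite big_nil mcoeff0.
case/andP=> u_s /IHs; rewrite big_cons mcoeffD mcoeffZ mcoeffU => ->.
rewrite inE eq_sym; case: eqP => [->|_]; last by rewrite mulr0 add0r.
by rewrite (negPf u_s) mulr1 addr0.
Qed.

Lemma mcoeff_trunc n f v : (trunc n f)@_v = f v *+ (weight v <= n)%N.
Proof. by rewrite mcoeff_sum_words ?forests_upto_uniq // mem_forests_upto. Qed.

Lemma mcoeff_homog n f v : (homog n f)@_v = f v *+ (weight v == n).
Proof.
rewrite /homog -big_filter mcoeff_sum_words ?filter_uniq ?forests_upto_uniq //.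
by rewrite mem_filter mem_forests_upto; case: eqP => [->|]; rewrite ?leqnn.
Qed.

Lemma approx_trunc n f : approx n f (trunc n f).
Proof. by move=> u le_u; rewrite mcoeff_trunc le_u. Qed.

Lemma approx_eqm n f X Y : approx n f X -> approx n f Y -> eqA n X Y.
Proof. by move=> aX aY u le_u; rewrite -aX // aY. Qed.

Lemma eqm_approx n f X Y : eqA n X Y -> approx n f X -> approx n f Y.
Proof. by move=> eXY aX u le_u; rewrite aX // eXY. Qed.

Lemma approxW m n f X : (m <= n)%N -> approx n f X -> approx m f X.
Proof. by move=> le_mn aX u le_um; apply/aX/(leq_trans le_um). Qed.

(** The usual way to an identity of series: a common approximation is found at every order, where
    the algebra of k<PT> is available. *)
Lemma approx_eq f g :
  (forall n, exists2 X, approx n f X & approx n g X) -> f = g.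
Proof.
by move=> a; apply/funext => u; have [X af ag] := a (weight u); rewrite af // ag.
Qed.

Lemma weight_eq0 u : (weight u == 0) = (u == [::]).
Proof. by case: u => [|[ts] u]. Qed.

Lemma ord_ge1P X : ordA 1 X <-> X@_[::] = 0.
Proof.
split=> [-> //|X0 u]; rewrite ltnS leqn0 weight_eq0.
by move/eqP->.
Qed.

Lemma approx_nil n f X : approx n f X -> X@_[::] = f [::].
Proof. by move=> ->. Qed.

Lemma mcoeff_one u : (1 : A)@_u = (u == [::])%:R.
Proof. by rewrite malg1E mbaseE mcoeffU eq_sym. Qed.

Lemma approx_ord1 n x X : approx n x X -> x [::] = 0 -> ordA 1 X.
Proof. by move=> aX x0; apply/ord_ge1P; rewrite (approx_nil aX). Qed.

Lemma approx_sub1 n g G :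
  approx n g G -> approx n (fun u => g u - sone u) (G - 1).
Proof. by move=> aG u le_u; rewrite mcoeffB mcoeff_one aG. Qed.

Lemma approx_one n : approx n sone 1.
Proof. by move=> u _; rewrite mcoeff_one. Qed.

Record filtered_op op : Prop := FilteredOp {
  fop_linearr : forall X, linear (op X);
  fop_linearl : forall c X X' Y, op (c *: X + X') Y = c *: op X Y + op X' Y;
  fop_ord : forall m n X Y, ordA m X -> ordA n Y -> ordA (m + n) (op X Y)
}.

Lemma mul_filtered_op : filtered_op *%R.
Proof.
split=> [X c Y Z|c X Y Z|m n X Y]; last exact: ordA_mul.
  by rewrite mulrDr -malg_scalerAr.
by rewrite mulrDl -scalerAl.
Qed.

Lemma tri_filtered_op : filtered_op (@tri k).
Proof.
split=> [X|c X Y Z|m n X Y]; first exact: tri_is_linear.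
  exact: tri_linearl.
exact: ordA_tri.
Qed.

Lemma star_filtered_op : filtered_op (@star k).
Proof.
split=> [X|c X Y Z|m n X Y]; first exact: star_is_linear.
  exact: star_linearl.
exact: ordA_star.
Qed.

Lemma eqm_op op n X X' Y Y' : filtered_op op ->
  eqA n X X' -> eqA n Y Y' -> eqA n (op X Y) (op X' Y').
Proof. by case=> lr ll o; apply: eqm_bilinear. Qed.

(** [complete2] prescribes a truncation for each coefficient; as [op] adds orders, terms of larger
    weight do not affect that coefficient, and any other approximations do as well. *)
Lemma approx_op op n f g X Y : filtered_op op ->
  approx n f X -> approx n g Y -> approx n (complete2 op f g) (op X Y).
Proof.
move=> fop aX aY u le_u; apply: (eqm_op fop) (leqnn _).
  by apply: approx_eqm (approxW le_u aX); apply: approx_trunc.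
by apply: approx_eqm (approxW le_u aY); apply: approx_trunc.
Qed.

Lemma approx_iter op n x y X Y i : filtered_op op ->
    approx n x X -> approx n y Y ->
  approx n (iter i (complete2 op x) y) (iter i (op X) Y).
Proof. by move=> fop aX aY; elim: i => // i IHi; apply: approx_op. Qed.

Lemma ord_iter op X Y i : filtered_op op -> ordA 1 X -> ordA i (iter i (op X) Y).
Proof.
move=> fop oX; elim: i => [|i IHi]; first exact: ord_ge_all.
by rewrite -add1n; apply: (fop_ord fop).
Qed.

(** The series stops at index [weight w] and the finite sum at [n]; the extra terms do not reach
    [w], since every application of [op X] raises the order by at least one. Exponentials,
    logarithms, [exp_op] and the geometric inverse all have this form. *)
Lemma approx_iter_sum op (c : nat -> k) n x y X Y : filtered_op op ->
    ordA 1 X -> approx n x X -> approx n y Y ->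
  approx n (fun w => \sum_(0 <= i < (weight w).+1) c i * iter i (complete2 op x) y w)
    (\sum_(i < n.+1) c i *: iter i (op X) Y).
Proof.
move=> fop oX aX aY u le_u; rewrite raddf_sum /=.
rewrite -(big_mkord xpredT (fun i => (c i *: iter i (op X) Y)@_u)).
rewrite [RHS](big_cat_nat _ (n := (weight u).+1)) //= [X in _ = _ + X]big_nat.
rewrite [X in _ = _ + X]big1 ?addr0 => [|i /andP[lt_u _]].
  apply: eq_big_nat => i _; rewrite mcoeffZ; congr (_ * _).
  exact: (approx_iter _ fop aX aY).
by rewrite mcoeffZ (ord_iter Y fop oX lt_u) mulr0.
Qed.

Lemma iter_mul1 X i : iter i ( *%R X) 1 = X ^+ i.
Proof. by elim: i => // i IHi; rewrite exprS -IHi. Qed.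

Lemma iter_star1 X i : iter i (star X) 1 = (X : starred k) ^+ i.
Proof. by elim: i => // i IHi; rewrite exprS -IHi. Qed.

Lemma approx_sexp n x X : approx n x X -> x [::] = 0 ->
  approx n (sexp x) (psum (exp_coef k) n X).
Proof.
move=> aX x0; have oX := approx_ord1 aX x0.
have := approx_iter_sum (exp_coef k) mul_filtered_op oX aX (@approx_one n).
by congr approx; apply: eq_bigr => i _; rewrite iter_mul1.
Qed.

Lemma slogE op g : slog (complete2 op) g = fun w =>
  \sum_(0 <= i < (weight w).+1)
    log_coef k i * iter i (complete2 op (fun u => g u - sone u)) sone w.
Proof.
apply/funext => w; rewrite [in RHS]big_ltn // {1}/log_coef invr0 mulr0 mul0r.
by rewrite add0r.
Qed.

Lemma approx_slog op n g G : filtered_op op -> approx n g G -> g [::] = 1 ->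
  approx n (slog (complete2 op) g)
    (\sum_(i < n.+1) log_coef k i *: iter i (op (G - 1)) 1).
Proof.
move=> fop aG g1; rewrite slogE; apply: approx_iter_sum => //; last first.
- exact: approx_one.
- exact: approx_sub1.
by apply: (approx_ord1 (approx_sub1 aG)); rewrite g1 subrr.
Qed.

Lemma approx_slog_mul n g G : approx n g G -> g [::] = 1 ->
  approx n (slog (@smul k) g) (psum (log_coef k) n (G - 1)).
Proof.
move=> aG g1; have := approx_slog mul_filtered_op aG g1.
by congr approx; apply: eq_bigr => i _; rewrite iter_mul1.
Qed.

Lemma approx_slog_star n g G : approx n g G -> g [::] = 1 ->
  approx n (slog (@sstar k) g) (psum (log_coef k) n (G - 1 : starred k)).
Proof.
move=> aG g1; have := approx_slog star_filtered_op aG g1.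
by congr approx; apply: eq_bigr => i _; rewrite iter_star1.
Qed.

End Series.

(** * Primitive and group-like elements *)

Section Primitive.
Variable k : fieldType.
Local Notation A := {malg k[forest]}.
Local Notation AA := {malg k[(forest * forest)%type]}.
Local Notation word u := (mbase k (u : forest)).
Local Notation word2 u v := (mbase k (u : forest, v : forest)).
Local Notation eqA := (@eqm k forest weight).
Local Notation eqAA := (@eqm k (forest * forest)%type weight2).
Implicit Types (X Y Z : A) (x : series k).

Definition prim_tens X : AA := tens X 1 + tens 1 X.

Lemma prim_tens_linear c X Y :
  prim_tens (c *: X + Y) = c *: prim_tens X + prim_tens Y.
Proof.
by rewrite /prim_tens tens_linearl tens_linearr scalerDr addrACA.
Qed.

Lemma prim_tens0 : prim_tens 0 = 0.
Proof. by rewrite /prim_tens linear0 tens0l addr0. Qed.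

Lemma prim_tensZ c X : prim_tens (c *: X) = c *: prim_tens X.
Proof.
by have := prim_tens_linear c X 0; rewrite prim_tens0 !addr0.
Qed.

Lemma prim_tensD X Y : prim_tens (X + Y) = prim_tens X + prim_tens Y.
Proof. by rewrite -[X]scale1r prim_tens_linear !scale1r. Qed.

Lemma prim_tensN X : prim_tens (- X) = - prim_tens X.
Proof. by rewrite -scaleN1r prim_tensZ scaleN1r. Qed.

(** The mixed part [tens X Y + tens Y X] of the product is symmetric in [X] and [Y], so it leaves
    the commutator. *)
Lemma bracket_tens X Y :
  prim_tens X * prim_tens Y - prim_tens Y * prim_tens X = prim_tens (X * Y - Y * X).
Proof.
have expand U V : prim_tens U * prim_tens V
    = (tens (U * V) 1 + tens V U) + (tens U V + tens 1 (U * V)).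
  by rewrite mulrDl !mulrDr !tensM !mul1r !mulr1 addrACA.
rewrite !expand prim_tensD prim_tensN /prim_tens.
move: (tens (X * Y) 1) (tens 1 (X * Y)) (tens (Y * X) 1) (tens 1 (Y * X)).
move: (tens X Y) (tens Y X) => a b c d e f.
rewrite [a + d]addrC [b + f]addrC [c + b + _]addrACA [e + a + _]addrACA.
rewrite [b + a]addrC; move: (c + d) (e + f) (a + b) => x y z.
by rewrite opprD addrACA subrr addr0.
Qed.

Lemma Lie_primitive X : Lie X -> cosh X = prim_tens X.
Proof.
elim=> {X} [t|X Y _ IX _ IY|c X _ IX|X Y _ IX _ IY].
- by rewrite letterE coshU big_unshuffles1 /prim_tens malg1E !tensU.
- by rewrite linearD /= prim_tensD IX IY.
- by rewrite linearZ /= prim_tensZ IX.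
by rewrite linearB /= !coshM IX IY bracket_tens.
Qed.

(* The Dynkin operator, weighted by the number of nodes of the last letter. *)
Fixpoint dynkin (w : forest) : A :=
  if w is t :: w' then
    word [:: t] * dynkin w' - dynkin w' * word [:: t]
    + ((w' == [::])%:R * (nodes t)%:R) *: word [:: t]
  else 0.

Lemma Lie0 : Lie (0 : A).
Proof. by rewrite -(scale0r (letter k (Node [::]))); apply/Lie_scale/Lie_letter. Qed.

Lemma Lie_sum (I : Type) (s : seq I) (F : I -> A) :
  (forall i, Lie (F i)) -> Lie (\sum_(i <- s) F i).
Proof. by move=> LF; elim/big_ind: _ => //; [apply: Lie0|apply: Lie_add]. Qed.

Lemma Lie_dynkin w : Lie (dynkin w).
Proof.
elim: w => [|t w IHw] /=; first exact: Lie0.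
rewrite -letterE; apply: Lie_add; last exact/Lie_scale/Lie_letter.
by apply: Lie_bracket => //; apply: Lie_letter.
Qed.

(** When [t] goes to the left word, the second half of its bracket cancels the terms in which [t]
    goes to the right word. What remains is [t] times the induction hypothesis, plus [nodes t] from
    the unshuffling with empty left word. *)
Lemma dynkin_convolution w :
  \sum_(p <- unshuffles w) dynkin p.1 * word p.2 = (weight w)%:R *: word w.
Proof.
elim: w => [|t w IHw]; first by rewrite big_unshuffles_nil mul0r scale0r.
rewrite big_unshuffles_cons /=.
under eq_bigr do rewrite mulrDl mulrBl -scalerAl -mulrA -mulrA word_cons -scalerA.
rewrite !big_split sumrN /=.
rewrite addrAC addrNK -mulr_sumr IHw -malg_scalerAr word_cons.
rewrite (unshuffles_counitl w (fun _ v => (nodes t)%:R *: word (t :: v))).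
by rewrite -scalerDl -natrD addnC.
Qed.

Definition dynkin_map : A -> A := linext dynkin.
HB.instance Definition _ := GRing.Linear.on dynkin_map.

Lemma Lie_dynkin_map X : Lie (dynkin_map X).
Proof. by apply: Lie_sum => w; apply/Lie_scale/Lie_dynkin. Qed.

(* Apply (dynkin * id) to both sides: as dynkin kills 1, the right-hand side
   gives dynkin X. *)
Lemma primitive_dynkin X : cosh X = prim_tens X ->
  dynkin_map X = linext (fun w => (weight w)%:R *: word w) X.
Proof.
pose conv := linext (fun p : forest * forest => dynkin p.1 * word p.2).
have convP c P Q : conv (c *: P + Q) = c *: conv P + conv Q by exact: linearP.
have conv_sum s (F : forest * forest -> AA) :
    conv (\sum_(p <- s) F p) = \sum_(p <- s) conv (F p) by exact: linear_sum.
have convU u v : conv (word2 u v) = dynkin u * word v by rewrite /conv linextU.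
have conv0 : conv 0 = 0 by exact: linear0.
move/(congr1 conv).
have -> : conv (cosh X) = linext (fun w => (weight w)%:R *: word w) X.
  elim/malg_lin_ind: X => [|c X Y IX IY|u]; first by rewrite !linear0 conv0.
    by rewrite cosh_linear convP IX IY linearP.
  rewrite coshU conv_sum [RHS]linextU -dynkin_convolution.
  by apply: eq_bigr => p _; rewrite convU.
move=> ->; elim/malg_lin_ind: X => [|c X Y IX IY|u].
- by rewrite prim_tens0 conv0 !linear0.
- by rewrite prim_tens_linear convP -IX -IY linearP.
rewrite /prim_tens malg1E !tensU -[word2 u _]scale1r convP scale1r !convU /=.
by rewrite mul0r addr0 -malg1E mulr1 /dynkin_map linextU.
Qed.

Lemma mcoeff_tens X Y p : (tens X Y)@_p = X@_p.1 * Y@_p.2.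
Proof.
elim/malg_lin_ind: X => [|c X X' IX IX'|u].
- by rewrite tens0l !mcoeff0 mul0r.
- by rewrite tens_linearl !mcoeffD !mcoeffZ IX IX' mulrDl mulrA.
elim/malg_lin_ind: Y => [|c Y Y' IY IY'|v].
- by rewrite linear0 !mcoeff0 mulr0.
- by rewrite tens_linearr !mcoeffD !mcoeffZ IY IY' mulrDr mulrCA.
case: p => a b; rewrite tensU !mbaseE !mcoeffU -natrM xpair_eqE.
by rewrite mulnb.
Qed.

Lemma mcoeff_graded (T : A -> AA) n x p : linear T ->
    (forall u q, weight u != weight2 q -> (T (word u))@_q = 0) ->
  (T (homog n x))@_p = (T (trunc n x))@_p *+ (weight2 p == n).
Proof.
move=> linT T0.
have TU (s : seq forest) (P : pred forest) : T (\sum_(u <- s | P u) x u *: << u >>)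
    = \sum_(u <- s | P u) x u *: T (word u).
  have T00 : T 0 = 0 by have := linT (-1) 0 0; rewrite scaler0 addr0 scaleN1r addNr.
  elim: s => [|u s IHs]; rewrite ?big_nil ?big_cons //.
  by case: (P u); rewrite // linT IHs mbaseE.
rewrite /homog /trunc !TU !raddf_sum /= -sumrMnl big_mkcond; apply: eq_bigr => u _.
rewrite !mcoeffZ; have [<-|ne_u] := eqVneq (weight u) (weight2 p); last first.
  by rewrite T0 // mulr0 mul0rn; case: ifP.
by rewrite [weight u == n]eq_sym eq_sym; case: eqP.
Qed.

Lemma cosh_graded u q : weight u != weight2 q -> (cosh (word u))@_q = 0.
Proof.
move=> ne_uq; rewrite coshU raddf_sum big_seq big1 // => p /weight_unshuffles eq_p.
rewrite /= mbaseE mcoeffU; case: eqP => // eq_pq.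
by case/negP: ne_uq; rewrite -eq_p -eq_pq; case: (p).
Qed.

Lemma prim_tens_graded u q : weight u != weight2 q -> (prim_tens (word u))@_q = 0.
Proof.
case: q => a b ne_u; rewrite /prim_tens mcoeffD !mcoeff_tens !mcoeff_one /=.
rewrite mbaseE !mcoeffU -!natrM !mulnb.
have /negPf-> : ~~ ((u == a) && (b == [::])).
  by apply: contra ne_u => /andP[/eqP-> /eqP->]; rewrite /weight2 /= addn0.
have /negPf-> : ~~ ((a == [::]) && (u == b)).
  by apply: contra ne_u => /andP[/eqP-> /eqP->]; rewrite /weight2.
by rewrite addr0.
Qed.

Definition primitive_mod n X := eqAA n (cosh X) (prim_tens X).

Definition primitive_series x :=
  forall n X, approx n x X -> primitive_mod n X.

Lemma eqm_tens n X X' Y Y' :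
  eqA n X X' -> eqA n Y Y' -> eqAA n (tens X Y) (tens X' Y').
Proof.
apply: eqm_bilinear; [exact: tens_is_linear|exact: tens_linearl|exact: ordAA_tens].
Qed.

Lemma eqm_prim_tens n X Y : eqA n X Y -> eqAA n (prim_tens X) (prim_tens Y).
Proof.
move=> eXY.
by apply: eqmD; apply: eqm_tens.
Qed.

Lemma eqm_primitive n X Y : eqA n X Y -> primitive_mod n X -> primitive_mod n Y.
Proof.
move=> eXY pX; apply: eqm_trans (eqm_sym (eqm_cosh eXY)) _.
exact: eqm_trans pX (eqm_prim_tens eXY).
Qed.

Lemma trunc_homog n x : trunc n x = \sum_(0 <= i < n.+1) homog i x.
Proof.
apply/malgP => u; rewrite mcoeff_trunc raddf_sum /=.
under eq_bigr do rewrite mcoeff_homog.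
rewrite big_mkord; have [le_u|lt_u] := leqP (weight u) n; last first.
  rewrite big1 // => i _; case: eqP => // eq_u.
  by have := ltn_ord i; rewrite -eq_u ltnS leqNgt lt_u.
rewrite (bigD1 (Ordinal (le_u : weight u < n.+1)%N)) //= eqxx big1 ?addr0 // => i.
by rewrite -val_eqE /= eq_sym => /negPf->.
Qed.

Lemma homog0 x : x [::] = 0 -> homog 0 x = 0.
Proof.
move=> x0; apply/malgP => u; rewrite mcoeff_homog mcoeff0 weight_eq0.
by case: eqP => [->|].
Qed.

Lemma Lie_hat_primitive x : Lie_hat k x -> primitive_series x.
Proof.
case=> x0 Lx n X aX.
apply: eqm_primitive (approx_eqm (@approx_trunc _ _ _) aX) _.
have Lt : Lie (trunc n x).
  rewrite trunc_homog; apply: Lie_sum => -[|i]; last exact: Lx.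
  by rewrite homog0 //; apply: Lie0.
by move=> u _; rewrite (Lie_primitive Lt).
Qed.

Lemma cosh_homog n x : primitive_series x -> cosh (homog n x) = prim_tens (homog n x).
Proof.
move=> px; apply/malgP => p; rewrite (mcoeff_graded _ _ _ (linext_is_linear _)).
  rewrite (mcoeff_graded _ _ _ prim_tens_linear); last exact: prim_tens_graded.
  by case: eqP => // eq_p; rewrite (px n (trunc n x)) ?eq_p //; apply: approx_trunc.
exact: cosh_graded.
Qed.

Lemma linext_weight_homog n x :
  linext (fun w => (weight w)%:R *: word w) (homog n x) = n%:R *: homog n x.
Proof.
rewrite /homog linear_sum scaler_sumr; apply: eq_bigr => u /eqP eq_u.
by rewrite linearZ /= -mbaseE linextU eq_u !scalerA mulrC.
Qed.

(** In weight [n], Dynkin's identity says that [n] times the component is a value of [dynkin_map],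
    hence a Lie element; characteristic zero permits division by [n]. *)
Lemma primitive_Lie_hat x : [pchar k] =i pred0 ->
  x [::] = 0 -> primitive_series x -> Lie_hat k x.
Proof.
move=> char0 x0 px; split=> // n n_gt0.
have n_neq0 : n%:R != 0 :> k by move/pcharf0P: char0 => ->; rewrite -lt0n.
rewrite -[homog n x](scalerK n_neq0); apply: Lie_scale.
rewrite -linext_weight_homog -primitive_dynkin; first exact: Lie_dynkin_map.
exact: cosh_homog.
Qed.

Definition group_like_mod n X := eqAA n (cosh X) (tens X X).

Lemma eqm_group_like n X Y : eqA n X Y -> group_like_mod n X -> group_like_mod n Y.
Proof.
move=> eXY pX; apply: eqm_trans (eqm_sym (eqm_cosh eXY)) _.
exact: eqm_trans pX (eqm_tens eXY eXY).
Qed.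

(** Trades the coefficientwise definition, whose truncation order varies with the pair, for
    congruences in the tensor square that hold for every approximation. *)
Lemma group_likeP (g : series k) :
  group_like k g <->
  (forall n X, approx n g X -> group_like_mod n X) /\ g [::] = 1.
Proof.
split=> -[gg g1].
  split=> // n X aX.
  apply: eqm_group_like (approx_eqm (@approx_trunc _ _ _) aX) _ => -[u v] le_uv.
  have := gg u v; rewrite mcoeff_tens !mcoeff_trunc /=.
  rewrite (leq_trans (leq_addr _ _) le_uv) (leq_trans (leq_addl _ _) le_uv) => <-.
  rewrite /scosh; apply: (eqm_cosh _ (leqnn _)).
  by apply: approx_eqm (approxW le_uv (@approx_trunc _ _ _)) _; apply: approx_trunc.
split=> // u v.
have := gg (weight u + weight v)%N _ (@approx_trunc _ _ _) (u, v) (leqnn _).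
by rewrite mcoeff_tens !mcoeff_trunc leq_addr leq_addl => <-.
Qed.

End Primitive.

Section GroupLike.
Variable k : fieldType.
Local Notation A := {malg k[forest]}.
Local Notation AA := {malg k[(forest * forest)%type]}.
Local Notation word u := (mbase k (u : forest)).
Local Notation word2 u v := (mbase k (u : forest, v : forest)).
Local Notation ordA := (@ord_ge k forest weight).
Local Notation ordAA := (@ord_ge k (forest * forest)%type weight2).
Local Notation eqA := (@eqm k forest weight).
Local Notation eqAA := (@eqm k (forest * forest)%type weight2).
Implicit Types (X Y Z G : A) (P Q : AA).

Lemma eqmAA_mul n P P' Q Q' : eqAA n P P' -> eqAA n Q Q' -> eqAA n (P * Q) (P' * Q').
Proof.
move=> eP eQ; rewrite (malg_mulE P Q) (malg_mulE P' Q').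
apply: (eqm_bilinear (bilext_is_linear _) (bilext_linearl _)) eP eQ => a b S T.
by rewrite -malg_mulE; apply: ordAA_mul.
Qed.

Lemma eqm_psum c m n P Q : eqAA n P Q -> eqAA n (psum c m P) (psum c m Q).
Proof.
move=> ePQ; have eX j : eqAA n (P ^+ j) (Q ^+ j).
  elim: j => [|j IHj]; first exact: eqm_refl.
  by rewrite (exprS P) (exprS Q); apply: eqmAA_mul.
by rewrite /psum; apply: eqm_sum => i; apply: eqmZ.
Qed.

Lemma cosh_psum c n X : cosh (psum c n X) = psum c n (cosh X).
Proof.
rewrite /psum linear_sum; apply: eq_bigr => i _; rewrite linearZ /=; congr (_ *: _).
by elim: (i : nat) => [|j IHj]; rewrite ?cosh1 // !exprS coshM IHj.
Qed.

Lemma tens_psuml c n X : tens (psum c n X) 1 = psum c n (tens X 1).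
Proof.
rewrite /psum tens_suml; apply: eq_bigr => i _.
have := tens_linearl (c i) (X ^+ i) 0 1; rewrite tens0l !addr0 => ->; congr (_ *: _).
elim: (i : nat) => [|j IHj]; first by rewrite !expr0 tens11.
by rewrite !exprS -IHj tensM mulr1.
Qed.

Lemma tens_psumr c n X : tens 1 (psum c n X) = psum c n (tens 1 X).
Proof.
rewrite /psum linear_sum; apply: eq_bigr => i _; rewrite linearZ /=; congr (_ *: _).
elim: (i : nat) => [|j IHj]; first by rewrite !expr0 tens11.
by rewrite !exprS -IHj tensM mulr1.
Qed.

Lemma ordAA_tens1 X : ordA 1 X -> ordAA 1 (tens X 1) /\ ordAA 1 (tens 1 X).
Proof.
move=> oX; split; [rewrite -[1%N]addn0|rewrite -[1%N]add0n]; exact: ordAA_tens.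
Qed.

(** [tens X 1] and [tens 1 X] commute, so the exponential of their sum is the product of their
    exponentials. *)
Lemma psum_exp_prim_tens n X : [pchar k] =i pred0 -> ordA 1 X ->
  eqAA n (psum (exp_coef k) n (prim_tens X))
    (tens (psum (exp_coef k) n X) (psum (exp_coef k) n X)).
Proof.
move=> char0 /ordAA_tens1[o1 o2]; apply/eqmP.
have comm_tens : tens X 1 * tens 1 X = tens 1 X * tens X 1.
  by rewrite !tensM !mulr1 !mul1r.
have := psum_exp_add (tensor_filtered k) char0 n o1 o2 comm_tens.
by rewrite -tens_psuml -tens_psumr tensM mulr1 mul1r.
Qed.

Lemma group_like_mod_exp n X : [pchar k] =i pred0 -> ordA 1 X ->
  primitive_mod n X -> group_like_mod n (psum (exp_coef k) n X).
Proof.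
move=> char0 oX pX; rewrite /group_like_mod cosh_psum.
exact: eqm_trans (eqm_psum _ _ pX) (psum_exp_prim_tens char0 oX).
Qed.

Lemma primitive_mod_log n G : [pchar k] =i pred0 -> ordA 1 (G - 1) ->
  group_like_mod n G -> primitive_mod n (psum (log_coef k) n (G - 1)).
Proof.
move=> char0 oG gG; set X := psum (log_coef k) n (G - 1).
have oX : ordA 1 X.
  by apply: (falg_psum (words_filtered k)) => //; rewrite /log_coef invr0 mulr0.
have eG : eqA n (psum (exp_coef k) n X) G.
  by apply/eqmP; have := psum_exp_log (words_filtered k) char0 n oG; rewrite subrKC.
have [o1 o2] := ordAA_tens1 oX.
have oP : ordAA 1 (prim_tens X) by apply: ord_geD.
(* With truncated series understood, cosh X = log (cosh G), and [cosh G] is congruent to [tens G G],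
   then to the tensor square of exp X, then to exp ([prim_tens X]), which the logarithm undoes. *)
apply: eqm_trans
  (_ : eqAA n (psum (log_coef k) n (psum (exp_coef k) n (prim_tens X) - 1)) _).
  rewrite /X cosh_psum linearB /= cosh1; apply: eqm_psum; apply: eqmB => //.
  apply: eqm_trans gG _; apply: eqm_trans (eqm_sym (eqm_tens eG eG)) _.
  exact/eqm_sym/psum_exp_prim_tens.
by apply/eqmP; apply: (psum_log_exp (tensor_filtered k) char0).
Qed.

Lemma linext_star_tens X X' Y :
  linext (fun p : forest * forest => word p.1 * tri (word p.2) Y) (tens X X')
  = X * tri X' Y.
Proof.
elim/malg_lin_ind: X => [|c X1 X2 IX1 IX2|u].
- by rewrite tens0l linear0 mul0r.
- by rewrite tens_linearl linearP /= IX1 IX2 mulrDl -scalerAl.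
elim/malg_lin_ind: X' => [|c X1 X2 IX1 IX2|v].
- by rewrite linear0 tri0l mulr0 linear0.
- by rewrite tens_linearr linearP /= IX1 IX2 tri_linearl mulrDr -malg_scalerAr.
by rewrite tensU linextU.
Qed.

Lemma star_group_like n X Y : group_like_mod n X -> eqA n (star X Y) (X * tri X Y).
Proof.
move=> gX; rewrite star_cosh -linext_star_tens; apply: eqm_linext gX => p.
apply: ordA_mul; first exact: ord_ge_base.
by rewrite -[weight p.2]addn0; apply: ordA_tri; [apply: ord_ge_base|apply: ord_ge_all].
Qed.

Lemma linext_tri_tens X X' Y Z :
  linext (fun p : forest * forest => tri (word p.1) Y * tri (word p.2) Z) (tens X X')
  = tri X Y * tri X' Z.
Proof.
elim/malg_lin_ind: X => [|c X1 X2 IX1 IX2|u].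
- by rewrite tens0l linear0 tri0l mul0r.
- by rewrite tens_linearl linearP /= IX1 IX2 tri_linearl mulrDl -scalerAl.
elim/malg_lin_ind: X' => [|c X1 X2 IX1 IX2|v].
- by rewrite linear0 tri0l mulr0 linear0.
- by rewrite tens_linearr linearP /= IX1 IX2 tri_linearl mulrDr -malg_scalerAr.
by rewrite tensU linextU.
Qed.

Lemma tri_mul_group_like n X Y Z :
  group_like_mod n X -> eqA n (tri X (Y * Z)) (tri X Y * tri X Z).
Proof.
move=> gX; rewrite tri_mul_cosh -linext_tri_tens; apply: eqm_linext gX => p.
apply: ordA_mul; [rewrite -[weight p.1]addn0|rewrite -[weight p.2]addn0];
  by apply: ordA_tri; [apply: ord_ge_base|apply: ord_ge_all].
Qed.

Lemma triX1 X : tri X 1 = X@_[::] *: 1.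
Proof.
elim/malg_lin_ind: X => [|c X1 X2 IX1 IX2|u].
- by rewrite tri0l mcoeff0 scale0r.
- by rewrite tri_linearl IX1 IX2 mcoeffD mcoeffZ scalerDl scalerA.
by rewrite tri1_word mbaseE mcoeffU scaler_nat.
Qed.

Lemma eqm_tri2 n P P' Q Q' : eqAA n P P' -> eqAA n Q Q' -> eqAA n (tri2 P Q) (tri2 P' Q').
Proof.
apply: eqm_bilinear; [exact: tri2_is_linear|exact: tri2_linearl|exact: ordAA_tri2].
Qed.

Lemma group_like_mod_tri n X Y :
  group_like_mod n X -> group_like_mod n Y -> group_like_mod n (tri X Y).
Proof.
move=> gX gY; rewrite /group_like_mod cosh_tri -tri2_tens; exact: eqm_tri2.
Qed.

Lemma group_like_mod_mul n X Y :
  group_like_mod n X -> group_like_mod n Y -> group_like_mod n (X * Y).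
Proof.
move=> gX gY; rewrite /group_like_mod coshM -tensM; exact: eqmAA_mul.
Qed.

(** By [tri_star], acting by [X] and then by [X'] is acting by [star X' X], hence trivial up to
    weight [n] in each factor. *)
Lemma tri2_inverse n X X' P : eqA n (star X' X) 1 ->
  eqAA n (tri2 (tens X' X') (tri2 (tens X X) P)) P.
Proof.
move=> eX; have inv Y : eqA n (tri X' (tri X Y)) Y.
  by rewrite -tri_star -[Y in eqA _ _ Y]tri1X; apply: (eqm_op (tri_filtered_op k)).
elim/malg_lin_ind: P => [|c P1 P2 IP1 IP2|[u v]]; first by rewrite !linear0.
  by rewrite !tri2_linearr; apply: eqm_lin.
by rewrite -tensU !tri2_tens; apply: eqm_tens.
Qed.

(* [tens X X] acts injectively, and [cosh Y] and [tens Y Y] have the same image. *)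
Lemma group_like_mod_tri_cancel n X X' Y : eqA n (star X' X) 1 ->
  group_like_mod n X -> group_like_mod n (tri X Y) -> group_like_mod n Y.
Proof.
move=> eX gX gXY; rewrite /group_like_mod.
apply: eqm_trans (eqm_sym (tri2_inverse (cosh Y) eX)) _.
apply: eqm_trans (_ : eqAA n _ _) (tri2_inverse (tens Y Y) eX).
apply: eqm_tri2 => //; rewrite tri2_tens.
by apply: eqm_trans gXY; rewrite cosh_tri; apply: eqm_tri2 => //; apply: eqm_sym.
Qed.

End GroupLike.

(** * The post-group and the Lie-Butcher group *)

Section PostGroup.
Variable k : fieldType.
Hypothesis char0 : [pchar k] =i pred0.
Local Notation A := {malg k[forest]}.
Local Notation ordA := (@ord_ge k forest weight).
Local Notation eqA := (@eqm k forest weight).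
Local Notation GL := (group_like k).
Implicit Types (f g h x y z : series k).

Lemma approx_smul n f g (X Y : A) :
  approx n f X -> approx n g Y -> approx n (smul f g) (X * Y).
Proof. exact/approx_op/mul_filtered_op. Qed.

Lemma approx_stri n f g (X Y : A) :
  approx n f X -> approx n g Y -> approx n (stri f g) (tri X Y).
Proof. exact/approx_op/tri_filtered_op. Qed.

Lemma approx_sstar n f g (X Y : A) :
  approx n f X -> approx n g Y -> approx n (sstar f g) (star X Y).
Proof. exact/approx_op/star_filtered_op. Qed.

Let atr n f := @approx_trunc k n f.

Lemma group_like_nil g : GL g -> g [::] = 1.
Proof. by case. Qed.

Lemma group_like_approx n g (X : A) : GL g -> approx n g X -> group_like_mod n X.
Proof. by move/group_likeP => [gg _]; apply: gg. Qed.

Lemma group_like_intro g : g [::] = 1 ->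
  (forall n, exists2 X, approx n g X & group_like_mod n X) -> GL g.
Proof.
move=> g1 gg; apply/group_likeP; split=> // n X aX; have [Y aY gY] := gg n.
exact: eqm_group_like (approx_eqm aY aX) gY.
Qed.

Lemma sexp_nil x : sexp x [::] = 1.
Proof. by rewrite /sexp big_nat1 invr1 mul1r. Qed.

Lemma slog_nil op g : @slog k op g [::] = 0.
Proof. by rewrite /slog big_geq. Qed.

Lemma smulA f g h : smul f (smul g h) = smul (smul f g) h.
Proof.
apply: approx_eq => n; exists (trunc n f * (trunc n g * trunc n h)).
  by do 2?apply: approx_smul; apply: atr.
by rewrite mulrA; do 2?apply: approx_smul; apply: atr.
Qed.

Lemma smul1 f : smul sone f = f.
Proof.
apply: approx_eq => n; exists (trunc n f); last exact: atr.
by rewrite -[trunc n f]mul1r; apply: approx_smul; [apply: approx_one|apply: atr].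
Qed.

Lemma smulr1 f : smul f sone = f.
Proof.
apply: approx_eq => n; exists (trunc n f); last exact: atr.
by rewrite -[trunc n f]mulr1; apply: approx_smul; [apply: atr|apply: approx_one].
Qed.

Lemma sstarA f g h : sstar f (sstar g h) = sstar (sstar f g) h.
Proof.
apply: approx_eq => n; exists (star (trunc n f) (star (trunc n g) (trunc n h))).
  by do 2?apply: approx_sstar; apply: atr.
by rewrite -starA; do 2?apply: approx_sstar; apply: atr.
Qed.

Lemma sstar1 f : sstar sone f = f.
Proof.
apply: approx_eq => n; exists (trunc n f); last exact: atr.
by rewrite -[trunc n f]star1X; apply: approx_sstar; [apply: approx_one|apply: atr].
Qed.

Lemma sstarr1 f : sstar f sone = f.
Proof.
apply: approx_eq => n; exists (trunc n f); last exact: atr.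
by rewrite -[trunc n f]starX1; apply: approx_sstar; [apply: atr|apply: approx_one].
Qed.

Lemma stri1 f : stri sone f = f.
Proof.
apply: approx_eq => n; exists (trunc n f); last exact: atr.
by rewrite -[trunc n f]tri1X; apply: approx_stri; [apply: approx_one|apply: atr].
Qed.

Lemma stri_sstar f g h : stri (sstar f g) h = stri f (stri g h).
Proof.
apply: approx_eq => n; exists (tri (trunc n f) (tri (trunc n g) (trunc n h))).
  by rewrite -tri_star; apply: approx_stri; [apply: approx_sstar|]; apply: atr.
by do 2?apply: approx_stri; apply: atr.
Qed.

Lemma sstar_group_like g y : GL g -> sstar g y = smul g (stri g y).
Proof.
move=> gg; apply: approx_eq => n.
exists (trunc n g * tri (trunc n g) (trunc n y)).
  apply: eqm_approx (approx_sstar (@atr n g) (@atr n y)).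
  exact/star_group_like/(group_like_approx gg)/atr.
by apply: approx_smul; [|apply: approx_stri]; apply: atr.
Qed.

Lemma stri_smul g y z : GL g -> stri g (smul y z) = smul (stri g y) (stri g z).
Proof.
move=> gg; apply: approx_eq => n.
exists (tri (trunc n g) (trunc n y) * tri (trunc n g) (trunc n z)).
  apply: eqm_approx (approx_stri (@atr n g) (approx_smul (@atr n y) (@atr n z))).
  exact/tri_mul_group_like/(group_like_approx gg)/atr.
by apply: approx_smul; apply: approx_stri; apply: atr.
Qed.

Lemma group_like_one : GL sone.
Proof.
apply: group_like_intro => // n; exists 1; first exact: approx_one.
by rewrite /group_like_mod cosh1 tens11.
Qed.

Lemma smul_nil f g : f [::] = 1 -> g [::] = 1 -> smul f g [::] = 1.
Proof.
(* At order 0 only the empty word counts, so 1 approximates every series with constant term 1. *)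
move=> f1 g1; have a1 h : h [::] = 1 -> approx 0 h 1.
  move=> h1 u; rewrite leqn0 weight_eq0 => /eqP->.
  by rewrite mcoeff_one.
by rewrite (approx_smul (a1 f f1) (a1 g g1)) // mulr1 mcoeff_one.
Qed.

Lemma stri_nil f g : f [::] = 1 -> g [::] = 1 -> stri f g [::] = 1.
Proof.
move=> f1 g1; have a1 h : h [::] = 1 -> approx 0 h 1.
  move=> h1 u; rewrite leqn0 weight_eq0 => /eqP->.
  by rewrite mcoeff_one.
by rewrite (approx_stri (a1 f f1) (a1 g g1)) // tri1X mcoeff_one.
Qed.

Lemma group_like_smul f g : GL f -> GL g -> GL (smul f g).
Proof.
move=> gf gg; apply: group_like_intro => [|n].
  by apply: smul_nil; apply: group_like_nil.
exists (trunc n f * trunc n g); first by apply: approx_smul; apply: atr.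
apply: group_like_mod_mul; [apply: group_like_approx gf _|apply: group_like_approx gg _];
  exact: atr.
Qed.

Lemma group_like_stri f g : GL f -> GL g -> GL (stri f g).
Proof.
move=> gf gg; apply: group_like_intro => [|n].
  by apply: stri_nil; apply: group_like_nil.
exists (tri (trunc n f) (trunc n g)); first by apply: approx_stri; apply: atr.
apply: group_like_mod_tri; [apply: group_like_approx gf _|apply: group_like_approx gg _];
  exact: atr.
Qed.

Lemma group_like_sstar f g : GL f -> GL g -> GL (sstar f g).
Proof.
by move=> gf gg; rewrite (sstar_group_like _ gf); apply/group_like_smul/group_like_stri.
Qed.

Lemma group_like_sexp x : Lie_hat k x -> GL (sexp x).
Proof.
move=> Lx; have [x0 _] := Lx; apply: group_like_intro => [|n]; first exact: sexp_nil.
exists (psum (exp_coef k) n (trunc n x)); first exact/approx_sexp/x0/atr.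
apply: group_like_mod_exp => //; first exact: approx_ord1 (@atr n x) x0.
exact/(Lie_hat_primitive Lx)/atr.
Qed.

Lemma ord1_sub1 n g (G : A) : approx n g G -> g [::] = 1 -> ordA 1 (G - 1).
Proof.
by move=> aG g1; apply: (approx_ord1 (approx_sub1 aG)); rewrite g1 subrr.
Qed.

Lemma sexp_slog g : g [::] = 1 -> sexp (slog (@smul k) g) = g.
Proof.
move=> g1; apply: approx_eq => n; exists (trunc n g); last exact: atr.
have := approx_sexp (approx_slog_mul (@atr n g) g1) (slog_nil _ _).
apply: eqm_approx; apply/eqmP.
have := psum_exp_log (words_filtered k) char0 n (ord1_sub1 (@atr n g) g1).
by rewrite subrKC.
Qed.

Lemma Lie_hat_slog g : GL g -> Lie_hat k (slog (@smul k) g).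
Proof.
move=> gg; have g1 := group_like_nil gg.
apply: primitive_Lie_hat => // [|n X aX]; first exact: slog_nil.
apply: eqm_primitive (approx_eqm (approx_slog_mul (@atr n g) g1) aX) _.
apply: primitive_mod_log => //; first exact: ord1_sub1 (@atr n g) g1.
exact/(group_like_approx gg)/atr.
Qed.

Lemma group_like_exp : GL = [set sexp x | x in Lie_hat k]%classic.
Proof.
apply/seteqP; split=> [g gg|_ [x Lx <-]]; last exact: group_like_sexp.
exists (slog (@smul k) g); first exact: Lie_hat_slog.
exact/sexp_slog/group_like_nil.
Qed.

Lemma smul_sexp x y : smul (sexp x) (sexp y) = sexp (BCH x y).
Proof. by rewrite /BCH sexp_slog // smul_nil // sexp_nil. Qed.

Lemma smul_inverse g : GL g -> exists2 h, GL h & smul g h = sone /\ smul h g = sone.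
Proof.
rewrite {1}group_like_exp => -[x [x0 Lx] <-]; pose y : series k := fun u => - x u.
have Ly : Lie_hat k y.
  split=> [|n n_gt0]; first by rewrite /y x0 oppr0.
  suff -> : homog n y = (-1) *: homog n x by apply/Lie_scale/Lx.
  by apply/malgP => u; rewrite mcoeffZ !mcoeff_homog mulN1r mulNrn.
(* Stated for a pair, to be used again with [x] and [y] exchanged. *)
have exp_opp (a b : series k) : a [::] = 0 -> b = (fun u => - a u) ->
    smul (sexp a) (sexp b) = sone.
  move=> a0 ->; apply: approx_eq => n; have aa := @atr n a.
  exists 1; last exact: approx_one.
  have ab : approx n (fun u => - a u) (- trunc n a).
    by move=> u /aa; rewrite mcoeffN => ->.
  have oa := approx_ord1 aa a0.
  have := approx_smul (approx_sexp aa a0) (approx_sexp ab _).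
  rewrite a0 oppr0 => /(_ erefl).
  apply: eqm_approx; apply: eqm_sym; apply/eqmP.
  have := psum_exp_add (words_filtered k) char0 n oa (ord_geN oa).
  rewrite mulrN mulNr subrr => /(_ erefl).
  rewrite [X in X - _](_ : _ = 1) // /psum big_ord_recl big1 => [|i _].
    by rewrite expr0 addr0 /exp_coef invr1 scale1r.
  by rewrite expr0n scaler0.
exists (sexp y); first exact: group_like_sexp.
split; first exact: exp_opp.
apply: exp_opp; first by case: Ly.
by apply/funext => u; rewrite opprK.
Qed.

(** The inverse of [g] for [sstar], as the geometric expansion of 1 / (1 + (g - 1)). *)
Definition sinv g : series k := fun w => \sum_(0 <= i < (weight w).+1)
  geo_coef k i * iter i (sstar (fun u => g u - sone u)) sone w.

Lemma approx_sinv n g (G : A) : approx n g G -> g [::] = 1 ->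
  approx n (sinv g) (psum (geo_coef k) n (G - 1 : starred k)).
Proof.
move=> aG g1; have oG := ord1_sub1 aG g1.
have := approx_iter_sum (geo_coef k) (star_filtered_op k) oG (approx_sub1 aG)
  (@approx_one k n).
by congr approx; apply: eq_bigr => i _; rewrite iter_star1.
Qed.

Lemma sinvP n (G : A) : ordA 1 (G - 1) ->
  let H := psum (geo_coef k) n (G - 1 : starred k) in
  eqA n (star H G) 1 /\ eqA n (star G H) 1.
Proof.
move=> oG H.
have := psum_geo_comm (starred_filtered k) n (G - 1 : starred k).
have := psum_geo (starred_filtered k) n oG.
have -> : 1 + (G - 1 : starred k) = G by exact: subrKC.
move=> oH eH; have oH' := oH; rewrite -eH in oH'.
split; apply/eqmP; [exact: oH'|exact: oH].
Qed.

Lemma sstar_sinv g : g [::] = 1 -> sstar (sinv g) g = sone /\ sstar g (sinv g) = sone.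
Proof.
move=> g1; split; apply: approx_eq => n; exists 1; try exact: approx_one.
  apply: eqm_approx (approx_sstar (approx_sinv (@atr n g) g1) (@atr n g)).
  exact: (@sinvP n _ (ord1_sub1 (@atr n g) g1)).1.
apply: eqm_approx (approx_sstar (@atr n g) (approx_sinv (@atr n g) g1)).
exact: (@sinvP n _ (ord1_sub1 (@atr n g) g1)).2.
Qed.

Lemma stri_sinv g c : g [::] = 1 ->
  stri (sinv g) (stri g c) = c /\ stri g (stri (sinv g) c) = c.
Proof. by move=> /sstar_sinv[e1 e2]; rewrite -!stri_sstar e1 e2 !stri1. Qed.

(** The coproduct of [sinv g] is not known at this point. Instead, [g] sends the element back to the
    group-like [c], and [group_like_mod_tri_cancel] transfers group-likeness from the image. *)
Lemma group_like_stri_sinv g c : GL g -> GL c -> GL (stri (sinv g) c).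
Proof.
move=> gg gc; have g1 := group_like_nil gg; set b := stri _ c.
have eb : stri g b = c by have [] := stri_sinv c g1.
have aH n := approx_sinv (@atr n g) g1.
apply: group_like_intro => [|n].
  apply: stri_nil; last exact: group_like_nil.
  by rewrite /sinv big_nat1 /geo_coef mul1r.
exists (trunc n b); first exact: atr.
have [eH _] := @sinvP n _ (ord1_sub1 (@atr n g) g1).
apply: (group_like_mod_tri_cancel eH); first exact/(group_like_approx gg)/atr.
by apply: (group_like_approx gc); rewrite -eb; apply: approx_stri; apply: atr.
Qed.

Lemma group_smul : is_group GL sone (@smul k).
Proof.
split; [exact: group_like_one|exact: group_like_smul| | |exact: smul_inverse].
  by move=> f g h _ _ _; apply: smulA.
by move=> f _; rewrite smul1 smulr1.
Qed.

Lemma stri_automorphism g : GL g -> is_automorphism GL (@smul k) (stri g).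
Proof.
move=> gg; have g1 := group_like_nil gg.
split=> [b|b c _ _|b c _ _ e|c gc].
- exact: group_like_stri.
- exact: stri_smul.
- by rewrite -(stri_sinv b g1).1 e (stri_sinv c g1).1.
exists (stri (sinv g) c); first exact: group_like_stri_sinv.
by rewrite (stri_sinv c g1).2.
Qed.

Lemma post_group : is_post_group GL sone (@smul k) (@stri k).
Proof.
split; [exact: group_smul|exact: stri_automorphism|].
by move=> f g h gf _ _; rewrite -(sstar_group_like _ gf) stri_sstar.
Qed.

Lemma group_sstar : is_group GL sone (@sstar k).
Proof.
split; [exact: group_like_one|exact: group_like_sstar| | |].
- by move=> f g h _ _ _; apply: sstarA.
- by move=> f _; rewrite sstar1 sstarr1.
move=> g gg; have g1 := group_like_nil gg.
(* Since [g * b = g . (g |> b)], a right inverse [b] must satisfy [g |> b = h], with [h] the inverse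
   for concatenation; this equation is solved by [sinv g]. *)
have [h gh [gh1 _]] := smul_inverse gg; have gb := group_like_stri_sinv gg gh.
have gb1 : sstar g (stri (sinv g) h) = sone.
  by rewrite (sstar_group_like _ gg) (stri_sinv h g1).2.
exists (stri (sinv g) h); first exact: gb.
split; first exact: gb1.
have [e1 _] := sstar_sinv g1.
(* A right inverse coincides with the left inverse [sinv g], so it is two-sided. *)
suff -> : stri (sinv g) h = sinv g by exact: e1.
by rewrite -[LHS]sstar1 -e1 -sstarA gb1 sstarr1.
Qed.

Lemma exp_op_Omega x y : exp_op (stri (Omega x)) y = stri (sexp x) y.
Proof.
apply: approx_eq => n; have e1 := sexp_nil x.
pose G := trunc n (sexp x); have aG : approx n (sexp x) G by exact: atr.
have oG := ord1_sub1 aG e1; pose W : A := psum (log_coef k) n (G - 1 : starred k).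
have oW : ordA 1 W.
  by apply: (falg_psum (starred_filtered k)) => //; rewrite /log_coef invr0 mulr0.
(* The [star]-exponential of [W] acting on [y]. It gives exp (L_W) y, because [tri_star] turns
   [star]-powers into iterated actions, and [G |> y], because [W] is the [star]-logarithm of [G]. *)
exists (tri (psum (exp_coef k) n (W : starred k)) (trunc n y)).
  have := approx_iter_sum (exp_coef k) (tri_filtered_op k) oW
    (approx_slog_star aG e1) (@atr n y).
  congr approx; rewrite /psum tri_suml; apply: eq_bigr => i _.
  have := tri_linearl (exp_coef k i) ((W : starred k) ^+ i) 0 (trunc n y).
  rewrite tri0l !addr0 => ->; congr (_ *: _).
  rewrite -iter_star1; elim: (i : nat) => [|j IHj] /=; first by rewrite tri1X.
  by rewrite tri_star -IHj.
apply: eqm_approx (approx_stri aG (@atr n y)).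
apply: (eqm_op (tri_filtered_op k)) => //; apply: eqm_sym; apply/eqmP.
have := psum_exp_log (starred_filtered k) char0 n oG.
by have -> : 1 + (G - 1 : starred k) = G by exact: subrKC.
Qed.

Lemma stri_sexp g y : GL g -> y [::] = 0 -> stri g (sexp y) = sexp (stri g y).
Proof.
move=> gg y0; apply: approx_eq => n; have ag := @atr n g; have ay := @atr n y.
(* [approx_sexp] requires a zero constant term; acting does not lower the order, so [g |> y]
   inherits it from [y]. *)
have gy0 : stri g y [::] = 0.
  have o1 := approx_ord1 ay y0.
  have := ordA_tri (@ord_ge_all k forest weight (trunc n g)) o1.
  by rewrite add0n => /(_ [::] isT) <-; apply: (approx_stri ag ay).
exists (psum (exp_coef k) n (tri (trunc n g) (trunc n y))); last first.
  exact: approx_sexp (approx_stri ag ay) gy0.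
apply: eqm_approx (approx_stri ag (approx_sexp ay y0)).
rewrite /psum linear_sum; apply: eqm_sum => i; rewrite linearZ; apply: eqmZ.
have gX := group_like_approx gg ag.
elim: (i : nat) => [|j IHj] /=.
  (* In power 0 the action multiplies 1 by the constant term of [g], which is 1. *)
  by rewrite triX1 (approx_nil ag) (group_like_nil gg) scale1r.
rewrite exprS [X in eqA _ _ X]exprS; apply: eqm_trans (tri_mul_group_like _ _ gX) _.
exact: (eqm_op (mul_filtered_op k)).
Qed.

End PostGroup.

Local Open Scope classical_set_scope.

Theorem theorem5p27 (k : fieldType) (char0 : [pchar k] =i pred0) :
  [/\ group_like k = [set sexp x | x in Lie_hat k],
      is_post_group (group_like k) sone (@smul k) (@stri k),
      (forall x y : series k, Lie_hat k x -> Lie_hat k y ->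
         smul (sexp x) (sexp y) = sexp (BCH x y) /\
         stri (sexp x) (sexp y) = sexp (exp_op (stri (Omega x)) y)),
      is_group (group_like k) sone (@sstar k)
    & forall x y : series k, Lie_hat k x -> Lie_hat k y ->
        sstar (sexp x) (sexp y)
        = sexp (BCH x (exp_op (stri (Omega x)) y))].
Proof.
have stri_exp x y : Lie_hat k x -> Lie_hat k y ->
    stri (sexp x) (sexp y) = sexp (exp_op (stri (Omega x)) y).
  move=> Lx [y0 _]; rewrite (exp_op_Omega char0).
  exact: (stri_sexp (group_like_sexp char0 Lx) y0).
split; [exact: group_like_exp|exact: post_group| |exact: group_sstar|].
  by move=> x y Lx Ly; split; [exact: smul_sexp|exact: stri_exp].
move=> x y Lx Ly; rewrite (sstar_group_like _ (group_like_sexp char0 Lx)).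
by rewrite (stri_exp x y Lx Ly) (smul_sexp char0).
Qed.
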